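(* Let $\{\mu_j\}_{j=1}^\infty$ be a sequence of probability measures on $\mathbb R$, let $\mu_{nk}$ be the probability measure with $\mu_{nk}((-\infty,x)):=\mu_k((-\infty,nx))$, $x\in\mathbb R$, $k=1,\dots,n$, and put $\mu^{(n)}:=\mu_{n1}\boxplus\dots\boxplus\mu_{nn}$. In order that $L(\mu^{(n)},\delta_0)\to0$ as $n\to\infty$ it is necessary and sufficient that, as $n\to\infty$, $$\eta_{n1}:=\sum_{k=1}^n\int_{\{|x|\ge n\}}\mu_k(dx)\to0,$$ $$\eta_{n2}:=\frac1n\sum_{k=1}^n\int_{(-n,n)}x\,\mu_k(dx)\to0,$$ $$\eta_{n3}:=\frac1{n^2}\sum_{k=1}^n\Big\{\int_{(-n,n)}x^2\,\mu_k(dx)-\Big(\int_{(-n,n)}x\,\mu_k(dx)\Big)^2\Big\}\to0.$$ In addition, for some absolute positive constant $c$, $$L(\mu^{(n)},\delta_0)\le c\Big((\eta_{n1}+\eta_{n3})^{1/6}+|\eta_{n2}|\Big),\quad n=1,2,\dots.$$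
   Context: $\delta_0$ is the point mass at $0$. $L(\mu,\nu):=\inf\{h:\mu((-\infty,x-h))-h\le\nu((-\infty,x))\le\mu((-\infty,x+h))+h,\ x\in\mathbb R\}$ is the L\'evy distance. $\boxplus$ is free additive convolution of probability measures on $\mathbb R$: with $F_\mu(z)=\big(\int_{\mathbb R}\frac{\mu(dt)}{z-t}\big)^{-1}$ for $z$ in the open upper half-plane $\mathbb C^+$ and $\mathcal F$ the class of all such functions $F_\mu$, $\mu_1\boxplus\mu_2$ is the unique probability measure $\mu$ with $F_\mu(z)=F_{\mu_1}(Z_1(z))$, where $Z_1,Z_2\in\mathcal F$ are the unique functions with $z=Z_1(z)+Z_2(z)-F_{\mu_1}(Z_1(z))$ and $F_{\mu_1}(Z_1(z))=F_{\mu_2}(Z_2(z))$ for $z\in\mathbb C^+$. *)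

(* Defs.v *)
From HB Require Import structures.
From mathcomp Require Import all_boot all_order all_algebra.
From mathcomp Require Import complex.
From mathcomp Require Import all_classical all_reals all_analysis.
From mathcomp Require Import measurable_realfun.

Set Implicit Arguments.
Unset Strict Implicit.
Unset Printing Implicit Defensive.

Import Order.TTheory GRing.Theory Num.Theory.
Import numFieldNormedType.Exports.

Local Open Scope classical_set_scope.
Local Open Scope complex_scope.
Local Open Scope ring_scope.

(* Borel probability measures on the real line. *)
Notation prob R := (probability (measurableTypeR R) R).

Definition delta0 (R : realType) : prob R :=
  @dirac _ (measurableTypeR R) (0 : R) R.

(* Only h >= 0 can belong to the set below, and h = 1 always does, so [inf] is
   the genuine infimum. *)
Definition levy (R : realType) (mu nu : prob R) : R :=
  inf [set h : R | forall x : R,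
    fine (mu `]-oo, (x - h)[%classic) - h <= fine (nu `]-oo, x[%classic) /\
    fine (nu `]-oo, x[%classic) <= fine (mu `]-oo, (x + h)[%classic) + h].

(* The integral of a complex-valued function is taken componentwise. *)
Definition cauchy_transform (R : realType) (mu : prob R) (z : R[i]) : R[i] :=
  (\int[mu]_t complex.Re (z - t%:C)^-1) +i*
  (\int[mu]_t complex.Im (z - t%:C)^-1).

Definition F_transform (R : realType) (mu : prob R) (z : R[i]) : R[i] :=
  (cauchy_transform mu z)^-1.

Definition upper_half_plane (R : realType) : set R[i] :=
  [set z | 0 < complex.Im z].

(* Elements of the class are functions on the upper half-plane: values of the
   total function Z elsewhere are irrelevant. *)
Definition class_F (R : realType) (Z : R[i] -> R[i]) : Prop :=
  exists nu : prob R,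
    forall z, upper_half_plane z -> Z z = F_transform nu z.

(* [is_free_conv mu1 mu2 mu] reads "mu is the free additive convolution of mu1
   and mu2". *)
Definition is_free_conv (R : realType) (mu1 mu2 mu : prob R) : Prop :=
  exists Z1 Z2 : R[i] -> R[i],
    [/\ class_F Z1,
        class_F Z2 &
        forall z, upper_half_plane z ->
          [/\ z = Z1 z + Z2 z - F_transform mu1 (Z1 z),
              F_transform mu1 (Z1 z) = F_transform mu2 (Z2 z) &
              F_transform mu z = F_transform mu1 (Z1 z)]].

(* [is_free_conv_upto nu n mu] reads "mu is the free additive convolution of
   nu 1, ..., nu n" (n >= 1), associated to the left. In the case n = 1,
   equality of measures is equality on Borel sets. *)
Inductive is_free_conv_upto (R : realType) (nu : nat -> prob R) :
    nat -> prob R -> Prop :=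
| is_free_conv_upto1 (mu : prob R) :
    (forall A, measurable A -> mu A = nu 1%N A) -> is_free_conv_upto nu 1 mu
| is_free_conv_uptoS (n : nat) (mu' mu : prob R) :
    is_free_conv_upto nu n mu' -> is_free_conv mu' (nu n.+1) mu ->
    is_free_conv_upto nu n.+1 mu.

Definition div_by (R : realType) (n : nat) (x : measurableTypeR R) :
  measurableTypeR R := (x : R) / n%:R.

Lemma measurable_div_by (R : realType) (n : nat) :
  measurable_fun setT (@div_by R n).
Proof. exact: mulrr_measurable. Qed.

HB.instance Definition _ (R : realType) (n : nat) :=
  isMeasurableFun.Build _ _ _ _ (@div_by R n) (@measurable_div_by R n).

Definition rescale (R : realType) (n : nat) (mu : prob R) : prob R :=
  distribution mu (@div_by R n).

Lemma rescaleE (R : realType) (n : nat) (mu : prob R) (x : R) : (0 < n)%N ->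
  rescale n mu `]-oo, x[%classic = mu `]-oo, (n%:R * x)[%classic.
Proof.
move=> n0; rewrite /rescale /distribution /pushforward /=; congr (mu _).
by apply/seteqP; split=> y /=; rewrite !in_itv /= /div_by ltr_pdivrMr ?ltr0n// mulrC.
Qed.

Definition eta1 (R : realType) (mu : nat -> prob R) (n : nat) : R :=
  \sum_(1 <= k < n.+1) fine (mu k [set x | n%:R <= `|x|]).

Definition eta2 (R : realType) (mu : nat -> prob R) (n : nat) : R :=
  n%:R^-1 * \sum_(1 <= k < n.+1) \int[mu k]_(x in `](- n%:R), n%:R[%classic) x.

Definition eta3 (R : realType) (mu : nat -> prob R) (n : nat) : R :=
  (n%:R ^+ 2)^-1 * \sum_(1 <= k < n.+1)
    (\int[mu k]_(x in `](- n%:R), n%:R[%classic) (x ^+ 2)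
     - (\int[mu k]_(x in `](- n%:R), n%:R[%classic) x) ^+ 2).

(* Main.v *)
Require Import Defs.
From mathcomp Require Import all_boot all_order all_algebra.
From mathcomp Require Import complex.
From mathcomp Require Import all_classical all_reals all_analysis.
From mathcomp Require Import measurable_realfun ring lra.
Import Order.TTheory GRing.Theory Num.Theory.
Import numFieldNormedType.Exports.
Local Open Scope classical_set_scope.
Local Open Scope complex_scope.
Local Open Scope ring_scope.

Set Implicit Arguments.
Unset Strict Implicit.
Unset Printing Implicit Defensive.

(** The reciprocal Cauchy transform F_nu satisfies
      Im F_nu(w) = Im w * (1 + Var),
    where Var is the mean of |F_nu(w) / (w - t) - 1|^2 under nu ([Im_F]). When mu is
    the free convolution of nu_1, ..., nu_n, iterating the definition provides
    functions W_k on the upper half-plane with F_{nu_k}(W_k(z)) = F_mu(z), Im W_k(z)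
    at least Im z, and
      z = F_mu(z) + sum_k (W_k(z) - F_mu(z))
    ([free_conv_subordination]). If every nu_k were the point mass at a_k, then
    F_{nu_k}(w) = w - a_k would give W_k - F_mu = a_k and F_mu(z) = z - sum_k a_k. The
    theorem is a perturbation of this computation, in both directions.

    Sufficiency and rate. Let a_k be the mean of nu_k truncated to (-1, 1), let a be
    the sum of the a_k, and let z = a + iy. The equation above becomes
      iy / F_mu(z) = 1 + sum_k d_k  with  d_k = (W_k(z) - a_k) / F_mu(z) - 1,
    and the mass which mu puts at distance at least y from a is at most
    2 |sum_k d_k| ([far_mass_le]). A second-order expansion of F_{nu_k} around a_k
    bounds d_k by the tail mass and the truncated variance of nu_k, provided that
    W_k(z) - a_k is of order y ([centred_cauchy_le]). This proviso follows from
    sum_k |d_k| <= 1/2, which holds for large y and propagates downwards by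
    continuity, as the estimate obtained under it is better than 1/2 ([H_le]).
    Taking y^3 of the order of eta1 + eta3 bounds the Levy distance to the point
    mass at eta2, hence also to the point mass at 0
    ([free_conv_concentration], [levy_rate]).

    Necessity. If mu is close to the point mass at 0, then F_mu(i) is close to i, and
    the imaginary part of the equation at z = i bounds the sum of the variances Var
    of the nu_k at W_k(i). Each nu_k is therefore concentrated near some real b_k,
    with a total error bounded by the Levy distance, and the real part of the
    equation shows that the b_k nearly sum to 0 ([free_conv_centres]). This does not
    make the b_k small for a single n. For the array at hand, comparing the centres
    at the stages n and n + 1 shows that the last one is small
    ([last_summand_small]), so the array is infinitesimal and the centres lie in
    (-1/2, 1/2). Concentration near such centres bounds the tails and the truncated
    variances ([centred_trunc]), which gives eta1 and eta3; finally eta2 tends to 0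
    because mu is concentrated near both eta2 and 0. *)

(** * The modulus of a complex number *)

Section Modulus.
Variable R : realType.
Implicit Types (z w : R[i]) (x y : R).

Local Notation nrm := (@Normc.normc R).
Local Notation Re := (@complex.Re R).
Local Notation Im := (@complex.Im R).

Lemma ReD z w : Re (z + w) = Re z + Re w. Proof. by case: z w => [? ?] []. Qed.
Lemma ImD z w : Im (z + w) = Im z + Im w. Proof. by case: z w => [? ?] []. Qed.
Lemma ReN z : Re (- z) = - Re z. Proof. by case: z. Qed.
Lemma ImN z : Im (- z) = - Im z. Proof. by case: z. Qed.
Lemma ReM z w : Re (z * w) = Re z * Re w - Im z * Im w.
Proof. by case: z w => [? ?] []. Qed.
Lemma ImM z w : Im (z * w) = Re z * Im w + Im z * Re w.
Proof. by case: z w => [? ?] []. Qed.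

Lemma complex_ext z w : Re z = Re w -> Im z = Im w -> z = w.
Proof. by case: z w => [? ?] [? ?] /= -> ->. Qed.

Lemma Re_sum (I : Type) (r : seq I) (P : pred I) (f : I -> R[i]) :
  Re (\sum_(i <- r | P i) f i) = \sum_(i <- r | P i) Re (f i).
Proof. by elim/big_rec2: _ => // i _ y _ <-; rewrite ReD. Qed.

Lemma Im_sum (I : Type) (r : seq I) (P : pred I) (f : I -> R[i]) :
  Im (\sum_(i <- r | P i) f i) = \sum_(i <- r | P i) Im (f i).
Proof. by elim/big_rec2: _ => // i _ y _ <-; rewrite ImD. Qed.

Lemma nrm_ge0 z : 0 <= nrm z. Proof. by case: z => a b; exact: sqrtr_ge0. Qed.

Lemma sqr_nrm z : nrm z ^+ 2 = Re z ^+ 2 + Im z ^+ 2.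
Proof. by case: z => a b; rewrite /= sqr_sqrtr // addr_ge0 ?sqr_ge0. Qed.

Lemma nrmD z w : nrm (z + w) <= nrm z + nrm w. Proof. exact: le_normcD. Qed.
Lemma nrmN z : nrm (- z) = nrm z. Proof. exact: normcN. Qed.
Lemma nrmM z w : nrm (z * w) = nrm z * nrm w. Proof. exact: Normc.normcM. Qed.
Lemma nrmV z : nrm z^-1 = (nrm z)^-1. Proof. exact: Normc.normcV. Qed.
Lemma nrm0 : nrm 0 = 0. Proof. exact: Normc.normc0. Qed.
Lemma nrm1 : nrm 1 = 1. Proof. exact: Normc.normc1. Qed.

Lemma nrmB z w : nrm (z - w) <= nrm z + nrm w.
Proof. by rewrite -(nrmN w); exact: nrmD. Qed.

Lemma nrm_distC z w : nrm (z - w) = nrm (w - z).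
Proof. by rewrite -nrmN opprB. Qed.

Lemma nrm_sub_ge z w : nrm z - nrm w <= nrm (z - w).
Proof. by rewrite lerBlDr; apply: le_trans (nrmD _ _); rewrite subrK. Qed.

Lemma nrm_sum (I : Type) (r : seq I) (P : pred I) (f : I -> R[i]) :
  nrm (\sum_(i <- r | P i) f i) <= \sum_(i <- r | P i) nrm (f i).
Proof.
elim/big_rec2: _ => [|i x y _ le]; first by rewrite nrm0.
by apply: le_trans (nrmD _ _) _; rewrite lerD2l.
Qed.

Lemma Re_le_nrm z : `|Re z| <= nrm z.
Proof.
rewrite -(ler_pXn2r (n := 2)) ?nnegrE ?nrm_ge0//.
by rewrite real_normK ?num_real// sqr_nrm lerDl sqr_ge0.
Qed.

Lemma Im_le_nrm z : `|Im z| <= nrm z.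
Proof.
rewrite -(ler_pXn2r (n := 2)) ?nnegrE ?nrm_ge0//.
by rewrite real_normK ?num_real// sqr_nrm lerDr sqr_ge0.
Qed.

Lemma nrm_le_ReIm z : nrm z <= `|Re z| + `|Im z|.
Proof.
rewrite -(ler_pXn2r (n := 2)) ?nnegrE ?nrm_ge0 ?addr_ge0//.
rewrite sqr_nrm sqrrD !real_normK ?num_real//.
by rewrite addrAC lerDl mulrn_wge0// mulr_ge0.
Qed.

Lemma nrm_real x : nrm x%:C = `|x|.
Proof. by rewrite /= expr0n /= addr0 sqrtr_sqr. Qed.

Lemma ReV z : Re z^-1 = Re z / nrm z ^+ 2.
Proof. by rewrite sqr_nrm; case: z. Qed.

Lemma ImV z : Im z^-1 = - Im z / nrm z ^+ 2.
Proof. by rewrite sqr_nrm; case: z => a b /=; rewrite mulNr. Qed.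

Lemma Im_gt0_neq0 z : 0 < Im z -> z != 0.
Proof. by move=> z0; apply/negP => /eqP ze; rewrite ze /= ltxx in z0. Qed.

Lemma Im_gt0_nrm z : 0 < Im z -> 0 < nrm z.
Proof. by move=> /lt_le_trans; apply; apply: le_trans (Im_le_nrm z); exact: ler_norm. Qed.

Lemma le_Im_nrm z : Im z <= nrm z.
Proof. by apply: le_trans (Im_le_nrm z); exact: ler_norm. Qed.

End Modulus.

(** * Means of bounded measurable functions *)

Section BoundedMeasurable.
Variable R : realType.
Implicit Types (f g : R -> R) (nu : prob R).

(** Every integrand below is bounded, so that integrability never has to be
    argued: this class is closed under the ring operations and truncation, and
    all its members are integrable. *)
Definition bmeas f := measurable_fun [set: measurableTypeR R] f /\
  exists M, forall t, `|f t| <= M.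

Lemma bmeas_cst c : bmeas (fun=> c).
Proof. by split; [exact: measurable_cst | exists `|c|]. Qed.

Lemma bmeasD f g : bmeas f -> bmeas g -> bmeas (fun t => f t + g t).
Proof.
move=> [mf [M fM]] [mg [N gN]]; split; first exact: measurable_funD.
by exists (M + N) => t; rewrite (le_trans (ler_normD _ _))// lerD.
Qed.

Lemma bmeasM f g : bmeas f -> bmeas g -> bmeas (fun t => f t * g t).
Proof.
move=> [mf [M fM]] [mg [N gN]]; split; first exact: measurable_funM.
by exists (M * N) => t; rewrite normrM ler_pM.
Qed.

Lemma bmeasN f : bmeas f -> bmeas (fun t => - f t).
Proof.
by move=> [mf [M fM]]; split; [exact: measurable_funN | exists M => t; rewrite normrN].
Qed.

Lemma bmeasB f g : bmeas f -> bmeas g -> bmeas (fun t => f t - g t).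
Proof. by move=> mf mg; apply: bmeasD => //; exact: bmeasN. Qed.

Lemma bmeas_sqr f : bmeas f -> bmeas (fun t => f t ^+ 2).
Proof. by move=> mf; exact: bmeasM. Qed.

Lemma bmeas_continuous f M : continuous f -> (forall t, `|f t| <= M) -> bmeas f.
Proof. by move=> cf fM; split; [exact: continuous_measurable_fun | exists M]. Qed.

Lemma bmeas_indic (A : set (measurableTypeR R)) : measurable A ->
  bmeas (\1_A : R -> R).
Proof.
move=> mA; split; first exact: measurable_indic.
by exists 1 => t; rewrite indicE; case: (_ \in _); rewrite ?normr0 ?normr1.
Qed.

(** Truncation is what makes the integrands bounded: the bound on f is only
    required on A. *)
Lemma bmeas_indicM (A : set (measurableTypeR R)) f M : measurable A ->
  measurable_fun [set: measurableTypeR R] f -> (forall t, A t -> `|f t| <= M) ->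
  bmeas (fun t => f t * \1_A t).
Proof.
move=> mA mf fM; split; first by apply: measurable_funM => //; exact: measurable_indic.
exists `|M| => t; rewrite indicE.
have [tA|_] := boolP (t \in A); last by rewrite mulr0 normr0.
by rewrite mulr1 (le_trans (fM _ _)) ?ler_norm//; exact/set_mem.
Qed.

Lemma bmeas_integrable nu f : bmeas f -> nu.-integrable setT (EFin \o f).
Proof.
move=> [mf [M fM]]; apply: measurable_bounded_integrable => //.
  exact: (le_lt_trans (probability_le1 nu measurableT) (ltry 1)).
exists M; split; first exact: num_real.
by move=> x Mx t _ /=; exact: (le_trans (fM t) (ltW Mx)).
Qed.

Lemma meanD nu f g : bmeas f -> bmeas g ->
  \int[nu]_t (f t + g t) = \int[nu]_t f t + \int[nu]_t g t.
Proof. by move=> mf mg; rewrite RintegralD//; exact: bmeas_integrable. Qed.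

Lemma meanB nu f g : bmeas f -> bmeas g ->
  \int[nu]_t (f t - g t) = \int[nu]_t f t - \int[nu]_t g t.
Proof. by move=> mf mg; rewrite RintegralB//; exact: bmeas_integrable. Qed.

Lemma meanZ nu c f : bmeas f -> \int[nu]_t (c * f t) = c * \int[nu]_t f t.
Proof. by move=> mf; rewrite RintegralZl//; exact: bmeas_integrable. Qed.

Lemma mean_cst nu c : \int[nu]_t c = c.
Proof.
by rewrite Rintegral_cst//= probability_setT mulr1.
Qed.

Lemma le_mean nu f g : bmeas f -> bmeas g -> (forall t, f t <= g t) ->
  \int[nu]_t f t <= \int[nu]_t g t.
Proof. by move=> mf mg fg; apply: le_Rintegral => //; exact: bmeas_integrable. Qed.

Lemma mean_ge0 nu f : (forall t, 0 <= f t) -> 0 <= \int[nu]_t f t.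
Proof. by move=> f0; exact: Rintegral_ge0. Qed.

Lemma mean_indic nu (A : set (measurableTypeR R)) : measurable A ->
  \int[nu]_t \1_A t = fine (nu A).
Proof. by move=> mA; rewrite /Rintegral integral_indic// setIT. Qed.

Lemma mean_on nu (A : set (measurableTypeR R)) f : 
  \int[nu]_(t in A) f t = \int[nu]_t (f t * \1_A t).
Proof. by rewrite Rintegral_mkcond; apply: eq_Rintegral => t _; rewrite patch_indic. Qed.

Lemma prob_ge0 nu (A : set (measurableTypeR R)) : 0 <= fine (nu A).
Proof. by rewrite fine_ge0. Qed.

Lemma prob_fin nu (A : set (measurableTypeR R)) : measurable A ->
  nu A = (fine (nu A))%:E.
Proof. by move=> mA; rewrite fineK// fin_num_measure. Qed.

Lemma prob_le1 nu (A : set (measurableTypeR R)) : measurable A -> fine (nu A) <= 1.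
Proof. by move=> mA; rewrite -lee_fin -prob_fin// probability_le1. Qed.

Lemma prob_mono nu (A B : set (measurableTypeR R)) : measurable A -> measurable B ->
  A `<=` B -> fine (nu A) <= fine (nu B).
Proof.
by move=> mA mB AB; rewrite -lee_fin -!prob_fin// le_measure ?inE.
Qed.

Lemma prob_setC nu (A : set (measurableTypeR R)) : measurable A ->
  fine (nu (~` A)) = 1 - fine (nu A).
Proof.
by move=> mA; rewrite probability_setC// fineB// ?fin_num_measure.
Qed.

Lemma prob_setU nu (A B : set (measurableTypeR R)) : measurable A -> measurable B ->
  fine (nu (A `|` B)) <= fine (nu A) + fine (nu B).
Proof.
move=> mA mB; rewrite -lee_fin EFinD -!prob_fin//; last exact: measurableU.
exact: measureU2.
Qed.

(** Markov's inequality. *)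
Lemma prob_le_mean nu (A : set (measurableTypeR R)) f c : measurable A ->
  bmeas f -> (forall t, 0 <= f t) -> (forall t, A t -> c <= f t) ->
  c * fine (nu A) <= \int[nu]_t f t.
Proof.
move=> mA mf f0 cf; rewrite -mean_indic// -meanZ; last exact: bmeas_indic.
apply: le_mean => //; first by apply: bmeasM; [exact: bmeas_cst | exact: bmeas_indic].
move=> t; rewrite indicE; case: (boolP (t \in A)) => [/set_mem/cf|]; rewrite ?mulr1// mulr0//.
Qed.

End BoundedMeasurable.

(** * Neighbourhoods, their complements, and tightness *)

Section Tails.
Variable R : realType.
Implicit Types (f : R -> R) (nu : prob R).

Lemma measurable_set_ge f c : measurable_fun [set: measurableTypeR R] f ->
  measurable ([set t | c <= f t] : set (measurableTypeR R)).
Proof.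
move=> mf; rewrite (_ : [set _ | _] = setT `&` f @^-1` `[c, +oo[%classic).
  exact: mf.
by apply/seteqP; split=> t /=; rewrite in_itv /= andbT => // -[].
Qed.

Lemma measurable_set_lt f c : measurable_fun [set: measurableTypeR R] f ->
  measurable ([set t | f t < c] : set (measurableTypeR R)).
Proof.
move=> mf; rewrite (_ : [set _ | _] = ~` [set t | c <= f t]).
  by apply: measurableC; exact: measurable_set_ge.
by apply/seteqP; split=> t /=; rewrite ltNge => /negP.
Qed.

Lemma measurable_dist (a : R) : measurable_fun [set: measurableTypeR R]
  (fun t : R => `|t - a|).
Proof.
apply: continuous_measurable_fun => t.
apply: (@continuous_comp _ _ _ (fun t => t - a) (fun t => `|t|)).
  by apply: continuousB => //; exact: cst_continuous.
exact: norm_continuous.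
Qed.

Definition far (a r : R) : set (measurableTypeR R) := [set t : R | r <= `|t - a|].
Definition near (a r : R) : set (measurableTypeR R) := [set t : R | `|t - a| < r].

Lemma measurable_far a r : measurable (far a r).
Proof. by apply: measurable_set_ge; exact: measurable_dist. Qed.

Lemma measurable_near a r : measurable (near a r).
Proof. by apply: measurable_set_lt; exact: measurable_dist. Qed.

Lemma near_setC a r : ~` far a r = near a r.
Proof. by apply/seteqP; split=> t; rewrite /far /near /= ltNge => /negP. Qed.

Lemma prob_near nu a r : fine (nu (near a r)) = 1 - fine (nu (far a r)).
Proof. by rewrite -near_setC prob_setC//; exact: measurable_far. Qed.

(** A probability measure has small tails, the complements of the intervals of
    integer radius being nested with empty intersection. *)
Lemma tight nu (e : R) : 0 < e -> exists2 M, 0 < M & fine (nu (far 0 M)) < e.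
Proof.
move=> e0; pose F (n : nat) := far 0 n%:R.
have I0 : \bigcap_n F n = set0.
  apply/seteqP; split=> // t /=; rewrite /bigcap /= => Ft.
  have := Ft (Num.truncn `|t : R|).+1 I; rewrite /F /far /= subr0.
  by rewrite leNgt truncnS_gt.
have := @nonincreasing_cvg_mu _ _ _ nu F.
rewrite I0 measure0 => cv.
have {}cv : (nu \o F) x @[x --> \oo] --> 0%E.
  apply: cv => //.
  - exact: (le_lt_trans (probability_le1 nu (measurable_far 0 _)) (ltry 1)).
  - by move=> i; exact: measurable_far.
  - move=> n m nm; apply/subsetPset => t; rewrite /F /far /=; apply: le_trans.
    by rewrite ler_nat.
have /fine_cvgP[_ /cvgrPdist_lt/(_ _ e0)[N _ HN]] := cv.
exists N.+1%:R => //; have := HN N.+1 (leqnSn _).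
by rewrite /= sub0r normrN ger0_norm// prob_ge0.
Qed.

End Tails.

(** * Means of complex functions *)

Section ComplexMean.
Variable R : realType.
Implicit Types (f g : R -> R[i]) (nu : prob R).
Local Notation nrm := (@Normc.normc R).
Local Notation Re := (@complex.Re R).
Local Notation Im := (@complex.Im R).

Definition cbmeas f := bmeas (fun t => Re (f t)) /\ bmeas (fun t => Im (f t)).

Definition cmean nu f : R[i] := (\int[nu]_t Re (f t)) +i* (\int[nu]_t Im (f t)).

Lemma cbmeas_cst c : cbmeas (fun=> c).
Proof. by split; exact: bmeas_cst. Qed.

Lemma cbmeas_real (f : R -> R) : bmeas f -> cbmeas (fun t => (f t)%:C).
Proof. by move=> mf; split=> //; exact: bmeas_cst. Qed.

Lemma cbmeasD f g : cbmeas f -> cbmeas g -> cbmeas (fun t => f t + g t).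
Proof.
move=> [rf jf] [rg jg]; split; under eq_fun do rewrite ?ReD ?ImD; exact: bmeasD.
Qed.

Lemma cbmeasN f : cbmeas f -> cbmeas (fun t => - f t).
Proof.
by move=> [rf jf]; split; under eq_fun do rewrite ?ReN ?ImN; exact: bmeasN.
Qed.

Lemma cbmeasB f g : cbmeas f -> cbmeas g -> cbmeas (fun t => f t - g t).
Proof. by move=> mf mg; apply: cbmeasD => //; exact: cbmeasN. Qed.

Lemma cbmeasM f g : cbmeas f -> cbmeas g -> cbmeas (fun t => f t * g t).
Proof.
move=> [rf jf] [rg jg]; split; under eq_fun do rewrite ?ReM ?ImM.
  by apply: bmeasB; exact: bmeasM.
by apply: bmeasD; exact: bmeasM.
Qed.

Lemma cbmeasZ c f : cbmeas f -> cbmeas (fun t => c * f t).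
Proof. by apply: cbmeasM; exact: cbmeas_cst. Qed.

Lemma bmeas_sqr_nrm f : cbmeas f -> bmeas (fun t => nrm (f t) ^+ 2).
Proof.
by move=> [rf jf]; under eq_fun do rewrite sqr_nrm; apply: bmeasD; exact: bmeas_sqr.
Qed.

Lemma cmean_cst nu c : cmean nu (fun=> c) = c.
Proof. by apply: complex_ext; rewrite /= mean_cst. Qed.

Lemma cmean_real nu (f : R -> R) : cmean nu (fun t => (f t)%:C) = (\int[nu]_t f t)%:C.
Proof. by apply: complex_ext; rewrite /= ?mean_cst. Qed.

Lemma cmeanZ nu c f : cbmeas f -> cmean nu (fun t => c * f t) = c * cmean nu f.
Proof.
move=> [rf jf]; apply: complex_ext; rewrite ?ReM ?ImM /= -!meanZ//.
- by rewrite -meanB; [apply: eq_Rintegral => t _; rewrite ReM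
    |apply: bmeasM => //; exact: bmeas_cst..].
- by rewrite -meanD; [apply: eq_Rintegral => t _; rewrite ImM
    |apply: bmeasM => //; exact: bmeas_cst..].
Qed.

Lemma cmeanB nu f g : cbmeas f -> cbmeas g ->
  cmean nu (fun t => f t - g t) = cmean nu f - cmean nu g.
Proof.
move=> [rf jf] [rg jg]; apply: complex_ext; rewrite ?ReD ?ImD ?ReN ?ImN /= -meanB//;
  by apply: eq_Rintegral => t _; rewrite ?ReD ?ImD ?ReN ?ImN.
Qed.

(** The triangle inequality for complex integrals: pairing the integral c with
    its own conjugate gives |c|^2 as the mean of Re (conj c * f), which is at
    most |c| times the mean of g. *)
Lemma nrm_cmean_le nu f (g : R -> R) : cbmeas f -> bmeas g ->
  (forall t, nrm (f t) <= g t) -> nrm (cmean nu f) <= \int[nu]_t g t.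
Proof.
move=> [rf jf] mg fg; set c := cmean nu f.
have [c0|c0] := eqVneq (nrm c) 0.
  by rewrite c0 mean_ge0// => t; exact: (le_trans (nrm_ge0 _) (fg t)).
have {}c0 : 0 < nrm c by rewrite lt_def c0 nrm_ge0.
have mr : bmeas (fun t => Re c * Re (f t)) by apply: bmeasM => //; exact: bmeas_cst.
have mi : bmeas (fun t => Im c * Im (f t)) by apply: bmeasM => //; exact: bmeas_cst.
have c2 : nrm c * nrm c = \int[nu]_t (Re c * Re (f t) + Im c * Im (f t)).
  by rewrite -expr2 sqr_nrm meanD// !meanZ.
rewrite -(ler_pM2l c0) c2 -meanZ//; apply: le_mean.
- exact: bmeasD.
- by apply: bmeasM => //; exact: bmeas_cst.
move=> t; apply: le_trans (_ : nrm c * nrm (f t) <= _); last first.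
  by rewrite ler_wpM2l ?nrm_ge0.
have -> : Re c * Re (f t) + Im c * Im (f t) = Re (conjc c * f t).
  by rewrite ReM; case: (c) => a b /=; ring.
apply: le_trans (ler_norm _) (le_trans (Re_le_nrm _) _).
rewrite nrmM (_ : nrm (conjc c) = nrm c)//.
by case: (c) => a b /=; rewrite sqrrN.
Qed.

End ComplexMean.

(** * The Cauchy transform and its reciprocal *)

Section Resolvent.
Variable R : realType.
Implicit Types (nu : prob R) (w z : R[i]) (t : R).
Local Notation nrm := (@Normc.normc R).
Local Notation Re := (@complex.Re R).
Local Notation Im := (@complex.Im R).

Definition res w t : R[i] := (w - t%:C)^-1.

Lemma cauchyE nu w : cauchy_transform nu w = cmean nu (res w).
Proof. by []. Qed.

Lemma Im_subr w t : Im (w - t%:C) = Im w.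
Proof. by rewrite ImD ImN /= oppr0 addr0. Qed.

Lemma subr_neq0 w t : 0 < Im w -> w - t%:C != 0.
Proof. by move=> w0; apply: Im_gt0_neq0; rewrite Im_subr. Qed.

Lemma nrm_subr_ge w t : Im w <= nrm (w - t%:C).
Proof. by rewrite -(Im_subr w t) le_Im_nrm. Qed.

Lemma nrm_res_le w t : 0 < Im w -> nrm (res w t) <= (Im w)^-1.
Proof.
move=> w0; rewrite nrmV lef_pV2 ?nrm_subr_ge// posrE//.
exact: lt_le_trans (nrm_subr_ge _ _).
Qed.

Lemma Im_res w t : 0 < Im w -> Im (res w t) = - Im w * nrm (res w t) ^+ 2.
Proof. by move=> w0; rewrite ImV Im_subr nrmV exprVn. Qed.

Lemma cbmeas_res w : 0 < Im w -> cbmeas (res w).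
Proof.
move=> w0.
have cont_n : continuous (fun t => (nrm (w - t%:C) ^+ 2)^-1).
  move=> t; apply: (@continuousV R R (fun t => nrm (w - t%:C) ^+ 2)).
    by rewrite expf_neq0// gt_eqF// (lt_le_trans w0)// nrm_subr_ge.
  have -> : (fun t => nrm (w - t%:C) ^+ 2) = (fun t => (Re w - t) ^+ 2 + Im w ^+ 2).
    by apply/funext => s; rewrite sqr_nrm Im_subr ReD ReN.
  apply: continuousD; last exact: cst_continuous.
  apply: (@continuous_comp _ _ _ (fun t => Re w - t) (fun t => t ^+ 2));
    last exact: exprn_continuous.
  by apply: continuousB => //; exact: cst_continuous.
split; apply: (@bmeas_continuous _ _ (Im w)^-1).
- have -> : (fun t => Re (res w t)) = (fun t => (Re w - t) * (nrm (w - t%:C) ^+ 2)^-1).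
    by apply/funext => t; rewrite ReV ReD ReN.
  move=> t; apply: (@continuousM R R (fun t => Re w - t)); last exact: cont_n.
  by apply: continuousB => //; exact: cst_continuous.
- by move=> t; exact: le_trans (Re_le_nrm _) (nrm_res_le _ _).
- have -> : (fun t => Im (res w t)) = (fun t => - Im w * (nrm (w - t%:C) ^+ 2)^-1).
    by apply/funext => t; rewrite ImV Im_subr.
  move=> t; apply: (@continuousM R R (fun=> - Im w) (fun t => (nrm (w - t%:C) ^+ 2)^-1));
    last exact: cont_n.
  exact: cst_continuous.
- by move=> t; exact: le_trans (Im_le_nrm _) (nrm_res_le _ _).
Qed.

Lemma Im_cauchy nu w : 0 < Im w ->
  Im (cauchy_transform nu w) = - Im w * \int[nu]_t (nrm (res w t) ^+ 2).
Proof.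
move=> w0; rewrite -meanZ; last exact/bmeas_sqr_nrm/cbmeas_res.
by apply: eq_Rintegral => t _; exact: Im_res.
Qed.

(** The resolvent is bounded below on an interval carrying positive mass. *)
Lemma mean_sqr_res_gt0 nu w : 0 < Im w -> 0 < \int[nu]_t (nrm (res w t) ^+ 2).
Proof.
move=> w0; have [M M0 nuM] : exists2 M, 0 < M & fine (nu (far 0 M)) < 1 by exact: tight.
have nuM' : 0 < fine (nu (near 0 M)) by rewrite prob_near subr_gt0.
have c0 : 0 < ((nrm w + M) ^+ 2)^-1.
  by rewrite invr_gt0 exprn_gt0// addr_gt0// Im_gt0_nrm.
apply: lt_le_trans (_ : ((nrm w + M) ^+ 2)^-1 * fine (nu (near 0 M)) <= _).
  by rewrite mulr_gt0.
apply: prob_le_mean; first exact: measurable_near.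
- exact/bmeas_sqr_nrm/cbmeas_res.
- by move=> t; rewrite sqr_ge0.
move=> t; rewrite /near /= subr0 => tM.
rewrite nrmV exprVn lef_pV2 ?posrE ?exprn_gt0 ?addr_gt0 ?Im_gt0_nrm ?Im_subr//.
rewrite ler_pXn2r// ?nnegrE ?nrm_ge0 ?addr_ge0 ?nrm_ge0 ?(ltW M0)//.
by apply: le_trans (nrmB _ _) _; rewrite nrm_real lerD2l ltW.
Qed.

Lemma cauchy_neq0 nu w : 0 < Im w -> cauchy_transform nu w != 0.
Proof.
move=> w0; apply/negP => /eqP /(congr1 Im); rewrite Im_cauchy//= => /eqP.
by rewrite mulf_eq0 oppr_eq0 !gt_eqF// mean_sqr_res_gt0.
Qed.

Lemma F_cauchy nu w : 0 < Im w -> F_transform nu w * cauchy_transform nu w = 1.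
Proof. by move=> w0; rewrite /F_transform mulVf// cauchy_neq0. Qed.

(** The relative deviation of the resolvent from its mean: writing F for
    F_transform nu w, one has dev t = (t - (w - F)) / (w - t), so that it
    vanishes nu-almost everywhere exactly when nu is a point mass. *)
Definition dev nu w t : R[i] := F_transform nu w * res w t - 1.

Definition defect nu w : R := \int[nu]_t (nrm (dev nu w t) ^+ 2).

Lemma cbmeas_dev nu w : 0 < Im w -> cbmeas (dev nu w).
Proof.
by move=> w0; apply: cbmeasB; [exact/cbmeasZ/cbmeas_res|exact: cbmeas_cst].
Qed.

Lemma mean_dev nu w : 0 < Im w -> cmean nu (dev nu w) = 0.
Proof.
move=> w0; rewrite cmeanB ?cmeanZ; [|exact: cbmeas_res
  |exact/cbmeasZ/cbmeas_res|exact: cbmeas_cst].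
by rewrite cmean_cst -cauchyE F_cauchy// subrr.
Qed.

Lemma defect_ge0 nu w : 0 <= defect nu w.
Proof. by apply: mean_ge0 => t; rewrite sqr_ge0. Qed.

(** Since Im (res w t) = - Im w * |res w t|^2, the imaginary part of F measures
    the second moment of the resolvent, and the excess Im F - Im w is Im w times
    its relative variance. This identity drives both directions: it shows that F
    does not decrease imaginary parts, and, for the necessity, that a small
    excess forces nu to be concentrated. *)
Lemma Im_F nu w : 0 < Im w -> Im (F_transform nu w) = Im w * (1 + defect nu w).
Proof.
move=> w0; set F := F_transform nu w; set m := \int[nu]_t (nrm (res w t) ^+ 2).
have mFr : cbmeas (fun t => F * res w t) by exact/cbmeasZ/cbmeas_res.
have mr2 := bmeas_sqr_nrm (cbmeas_res w0).
have FI : Im F = Im w * m * nrm F ^+ 2.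
  by rewrite /F /F_transform ImV Im_cauchy// nrmV exprVn; rewrite /m; ring.
have Fm : \int[nu]_t Re (F * res w t) = 1.
  rewrite -[LHS]/(Re (cmean nu (fun t => F * res w t))) cmeanZ; last exact: cbmeas_res.
  by rewrite -cauchyE F_cauchy.
suff -> : defect nu w = nrm F ^+ 2 * m - 1 by rewrite FI; ring.
have mF : bmeas (fun t => 2 * Re (F * res w t)).
  by apply: bmeasM; [exact: bmeas_cst|exact: mFr.1].
have mF2 : bmeas (fun t => nrm F ^+ 2 * nrm (res w t) ^+ 2).
  by apply: bmeasM => //; exact: bmeas_cst.
have -> : defect nu w =
   \int[nu]_t (nrm F ^+ 2 * nrm (res w t) ^+ 2 - (2 * Re (F * res w t) - 1)).
  apply: eq_Rintegral => t _; rewrite -exprMn -nrmM /dev -/F !sqr_nrm.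
  by rewrite ReD ImD ReN ImN /=; ring.
rewrite meanB//; last by apply: bmeasB => //; exact: bmeas_cst.
rewrite [X in _ - X]meanB//; last exact: bmeas_cst.
by rewrite !meanZ// ?mean_cst ?Fm; [rewrite /m; ring|exact: mFr.1].
Qed.

Lemma Im_F_ge nu w : 0 < Im w -> Im w <= Im (F_transform nu w).
Proof. by move=> w0; rewrite Im_F// mulrDr mulr1 lerDl mulr_ge0 ?defect_ge0// ltW. Qed.

Lemma nrm_cauchy_le nu w : 0 < Im w -> nrm (cauchy_transform nu w) <= (Im w)^-1.
Proof.
move=> w0; rewrite -(mean_cst nu (Im w)^-1) cauchyE.
apply: nrm_cmean_le; [exact: cbmeas_res|exact: bmeas_cst|].
by move=> t; exact: nrm_res_le.
Qed.

End Resolvent.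

(** * Subordination functions of an iterated free convolution *)

Section Subordination.
Variable R : realType.
Implicit Types (nu mu : prob R) (w z : R[i]) (t : R) (W V : R[i] -> R[i]).
Local Notation nrm := (@Normc.normc R).
Local Notation Re := (@complex.Re R).
Local Notation Im := (@complex.Im R).

(** Continuity on the open upper half-plane, in epsilon-delta form relative to
    the half-plane because members of [class_F] are arbitrary outside of it. *)
Definition ccont W := forall z, 0 < Im z -> forall e, 0 < e ->
  exists2 d, 0 < d & forall z', 0 < Im z' -> nrm (z' - z) < d -> nrm (W z' - W z) < e.

(** W z ~ z as z tends to infinity nontangentially. The cones are parametrised
    by their aperture a, since composition sends a cone into a wider one; as
    Im z <= |z|, they are empty unless 1 <= a. *)
Definition asymp_id W := forall a e, 1 <= a -> 0 < e ->
  exists2 Y, 0 < Y & forall z, Y <= Im z -> nrm z <= a * Im z -> nrm (W z - z) <= e * Im z.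

(** The properties of the members of [class_F] that are used; unlike membership
    in the class itself, they are plainly stable under composition. *)
Definition subord W := [/\ forall z, 0 < Im z -> Im z <= Im (W z), ccont W & asymp_id W].

Lemma ccont_inv W : ccont W -> (forall z, 0 < Im z -> W z != 0) ->
  ccont (fun z => (W z)^-1).
Proof.
move=> cW W0 z z0 e e0.
have n0 : 0 < nrm (W z).
  rewrite lt_def nrm_ge0 andbT; apply: contra (W0 _ z0) => /eqP/Normc.eq0_normc ->//.
pose e' := Num.min (nrm (W z) / 2) (e * nrm (W z) ^+ 2 / 2).
have e'0 : 0 < e' by rewrite lt_min !divr_gt0// mulr_gt0// exprn_gt0.
have [d d0 H] := cW _ z0 _ e'0; exists d => // z' z'0 /H -/(_ z'0).
rewrite lt_min => /andP[H1 H2].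
have n'0 : nrm (W z) / 2 < nrm (W z').
  have := nrm_sub_ge (W z) (W z'); rewrite nrm_distC; lra.
have n'p : 0 < nrm (W z') by apply: lt_trans n'0; rewrite divr_gt0.
have -> : (W z')^-1 - (W z)^-1 = (W z - W z') * ((W z)^-1 * (W z')^-1).
  by field; rewrite !W0.
rewrite !nrmM !nrmV nrm_distC -invfM ltr_pdivrMr ?mulr_gt0//.
apply: lt_le_trans H2 _.
rewrite -mulrA ler_pM2l// expr2 -mulrA ler_pM2l//; exact: ltW.
Qed.

Lemma ccont_comp W V : (forall z, 0 < Im z -> Im z <= Im (V z)) ->
  ccont W -> ccont V -> ccont (W \o V).
Proof.
move=> V0 cW cV z z0 e e0.
have [d d0 H] := cW _ (lt_le_trans z0 (V0 _ z0)) _ e0.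
have [d' d'0 H'] := cV _ z0 _ d0.
exists d' => // z' z'0 /(H' _ z'0); apply: H; exact: lt_le_trans (V0 _ z'0).
Qed.

(** The resolvent identity makes the Cauchy transform Lipschitz away from the
    real line. *)
Lemma ccont_cauchy nu : ccont (cauchy_transform nu).
Proof.
move=> z z0 e e0.
pose d := Num.min (Im z / 2) (e * Im z ^+ 2 / 2).
have d0 : 0 < d by rewrite lt_min !divr_gt0// mulr_gt0// exprn_gt0.
exists d => // z' z'0; rewrite lt_min => /andP[H1 H2].
have z'2 : Im z / 2 < Im z'.
  have := le_lt_trans (Im_le_nrm _) H1; rewrite ImD ImN ltr_norml => /andP[]; lra.
have mz := cbmeas_res z0; have mz' := cbmeas_res z'0.
rewrite !cauchyE -cmeanB//.
apply: le_lt_trans (_ : nrm (z' - z) / (Im z' * Im z) < _); last first.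
  rewrite ltr_pdivrMr ?mulr_gt0//; apply: lt_le_trans H2 _.
  rewrite -mulrA ler_pM2l// expr2 mulrAC ler_pM2r//; exact: ltW.
rewrite -[leRHS](mean_cst nu); apply: nrm_cmean_le.
- exact: cbmeasB.
- exact: bmeas_cst.
move=> t; have -> : res z' t - res z t = (z - z') * (res z' t * res z t).
  by rewrite /res; field; rewrite !subr_neq0.
rewrite !nrmM nrm_distC ler_wpM2l ?nrm_ge0// invfM.
by rewrite ler_pM ?nrm_ge0 ?nrm_res_le.
Qed.

Lemma ccont_F nu : ccont (F_transform nu).
Proof. by apply: ccont_inv; [exact: ccont_cauchy|move=> z z0; exact: cauchy_neq0]. Qed.

(** z * res z t - 1 = t * res z t is at most M / Im z for |t| < M, and at most
    a + 1 on the tail of nu, whose mass is small. *)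
Lemma asymp_cauchy nu a e : 1 <= a -> 0 < e -> exists2 Y, 0 < Y &
  forall z, Y <= Im z -> nrm z <= a * Im z -> nrm (z * cauchy_transform nu z - 1) <= e.
Proof.
move=> a1 e0.
have a0 : 0 < a + 1 by lra.
have [|M M0 nuM] := @tight _ nu (e / (2 * (a + 1))); first by rewrite divr_gt0// mulr_gt0.
exists (2 * M / e); first by rewrite divr_gt0// mulr_gt0.
move=> z Yz za; have z0 : 0 < Im z by apply: lt_le_trans Yz; rewrite divr_gt0// mulr_gt0.
have mr := cbmeas_res z0.
have mI : bmeas (\1_(far 0 M) : R -> R) by apply: bmeas_indic; exact: measurable_far.
have mI' : bmeas (fun t => (a + 1) * \1_(far 0 M) t) by apply: bmeasM => //; exact: bmeas_cst.
rewrite cauchyE -cmeanZ// -(cmean_cst nu 1) -cmeanB; last 2 first.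
- exact: cbmeasZ.
- exact: cbmeas_cst.
apply: le_trans (_ : \int[nu]_t (M / Im z + (a + 1) * \1_(far 0 M) t) <= _).
  apply: nrm_cmean_le.
  - by apply: cbmeasB; [exact: cbmeasZ|exact: cbmeas_cst].
  - by apply: bmeasD => //; exact: bmeas_cst.
  move=> t; rewrite indicE; case: (boolP (t \in _)) => [_|/negP tM].
    rewrite mulr1; apply: le_trans (nrmB _ _) _; rewrite nrm1 nrmM.
    apply: le_trans (_ : a + 1 <= _); last by rewrite lerDr divr_ge0 ?ltW.
    rewrite lerD2r; apply: le_trans (ler_wpM2l (nrm_ge0 _) (nrm_res_le _ z0)) _.
    by rewrite ler_pdivrMr.
  have tM' : `|t| < M.
    by rewrite ltNge; apply/negP => h; apply: tM; rewrite inE /far /= subr0.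
  rewrite mulr0 addr0.
  have -> : z * res z t - 1 = t%:C * res z t.
    by rewrite /res; field; exact: subr_neq0.
  by rewrite nrmM nrm_real ler_pM ?nrm_ge0 ?nrm_res_le// ltW.
rewrite meanD//; last exact: bmeas_cst.
rewrite mean_cst meanZ// mean_indic; last exact: measurable_far.
rewrite (splitr e) lerD//.
  by rewrite ler_pdivrMr// mulrC -ler_pdivrMr ?divr_gt0//; rewrite invf_div mulrCA mulrA.
move: nuM; rewrite invfM mulrA ltr_pdivlMr// mulrC; exact: ltW.
Qed.

Lemma asymp_F nu : asymp_id (F_transform nu).
Proof.
move=> a e a1 e0; have a0 : 0 < a by lra.
pose e' := Num.min (2^-1) (e / (2 * a)).
have e'0 : 0 < e' by rewrite lt_min invr_gt0 ltr0n divr_gt0// mulr_gt0.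
have [Y Y0 H] := asymp_cauchy nu a1 e'0; exists Y => // z Yz za.
have z0 : 0 < Im z by exact: lt_le_trans Yz.
have := H _ Yz za; rewrite le_min => /andP[H1 H2].
set F := F_transform nu z; set G := cauchy_transform nu z in H1 H2.
have FG : F * G = 1 by exact: F_cauchy.
have -> : F - z = F * (1 - z * G) by rewrite mulrBr mulr1 mulrCA FG mulr1.
have nF : nrm F <= 2 * (a * Im z).
  have : 2^-1 <= nrm (z * G).
    have := nrm_sub_ge 1 (z * G); rewrite nrm1 nrm_distC; lra.
  have FGn : nrm F * nrm G = 1 by rewrite -nrmM FG nrm1.
  rewrite nrmM => h.
  have : nrm F * 2^-1 <= nrm F * (nrm z * nrm G) by rewrite ler_wpM2l// nrm_ge0.
  rewrite mulrCA FGn mulr1; move: za; lra.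
rewrite nrmM nrm_distC.
apply: le_trans (ler_pM (nrm_ge0 _) (nrm_ge0 _) nF H2) _.
rewrite le_eqVlt; apply/orP; left; apply/eqP; field; lra.
Qed.

Lemma subord_F nu : subord (F_transform nu).
Proof. by split; [exact: Im_F_ge|exact: ccont_F|exact: asymp_F]. Qed.

Lemma subord_ext W V : (forall z, 0 < Im z -> W z = V z) -> subord V -> subord W.
Proof.
move=> WV [V1 V2 V3]; split.
- by move=> z z0; rewrite WV ?V1.
- move=> z z0 e e0; have [d d0 H] := V2 z z0 e e0.
  by exists d => // z' z'0 zd; rewrite !WV// H.
- move=> a e a1 e0; have [Y Y0 H] := V3 a e a1 e0.
  by exists Y => // z Yz za; rewrite WV ?H// (lt_le_trans Y0).
Qed.

Lemma subord_id : subord id.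
Proof.
split=> //; first by move=> z z0 e e0; exists e.
move=> a e a1 e0; exists 1 => // z z1 _.
by rewrite subrr nrm0 mulr_ge0 ?(ltW e0)// (le_trans ler01).
Qed.

Lemma subord_comp W V : subord W -> subord V -> subord (W \o V).
Proof.
move=> [W1 W2 W3] [V1 V2 V3]; split.
- move=> z z0 /=; apply: le_trans (V1 _ z0) (W1 _ _); exact: lt_le_trans (V1 _ z0).
- exact: ccont_comp.
move=> a e a1 e0.
have a2 : 1 <= a + 1 by lra.
have a0 : 0 < a + 2 by lra.
have e2 : 0 < Num.min 1 (e / (a + 2)) by rewrite lt_min ltr01 divr_gt0.
have [Y Y0 H] := V3 a _ a1 e2; have [Y' Y'0 H'] := W3 _ _ a2 e2.
exists (Num.max Y Y'); first by rewrite lt_max Y0.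
move=> z; rewrite ge_max => /andP[Yz Y'z] za.
have z0 : 0 < Im z by exact: lt_le_trans Yz.
have Hz := H _ Yz za; have Vz := V1 _ z0.
have Hz1 : nrm (V z - z) <= Im z.
  by apply: le_trans Hz _; rewrite ler_piMl ?(ltW z0)// ge_min lexx.
have Vn : nrm (V z) <= (a + 1) * Im z.
  by rewrite -(subrK z (V z)) (le_trans (nrmD _ _))//; lra.
have ImV : Im (V z) <= (a + 1) * Im z by exact: le_trans (le_Im_nrm _) Vn.
have Va : nrm (V z) <= (a + 1) * Im (V z).
  by apply: le_trans Vn _; rewrite ler_wpM2l//; lra.
have HV := H' _ (le_trans Y'z Vz) Va.
rewrite /= -(subrK (V z) (W (V z))) -addrA.
apply: le_trans (nrmD _ _) _.
apply: le_trans (lerD HV Hz) _.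
have m : Num.min 1 (e / (a + 2)) <= e / (a + 2) by rewrite ge_min lexx orbT.
apply: le_trans (_ : (e / (a + 2)) * ((a + 1) * Im z + Im z) <= _).
  rewrite mulrDr; apply: lerD; last by rewrite ler_wpM2r// ltW.
  by apply: ler_pM => //; rewrite ltW// (lt_le_trans z0).
rewrite le_eqVlt; apply/orP; left; apply/eqP; field; lra.
Qed.

Lemma class_F_subord Z : class_F Z -> subord Z.
Proof. by move=> [nu ZF]; apply: (@subord_ext _ (F_transform nu)) => //; exact: subord_F. Qed.

Lemma F_transform_ext nu mu : (forall A, measurable A -> mu A = nu A) ->
  F_transform mu =1 F_transform nu.
Proof.
move=> E z; rewrite /F_transform /cauchy_transform /Rintegral.
by congr (((fine _) +i* (fine _))^-1); apply: eq_measure_integral => A mA _; exact: E.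
Qed.

(** Composing the subordination functions of the successive binary convolutions
    subordinates mu to each summand, and the functional equation telescopes. *)
Lemma free_conv_subordination (nu : nat -> prob R) n mu : is_free_conv_upto nu n mu ->
  exists W : nat -> R[i] -> R[i],
    (forall k, (0 < k <= n)%N -> subord (W k)) /\
    forall z, 0 < Im z ->
      (forall k, (0 < k <= n)%N -> F_transform (nu k) (W k z) = F_transform mu z) /\
      z = F_transform mu z + \sum_(1 <= k < n.+1) (W k z - F_transform mu z).
Proof.
elim=> {n mu} [mu E|n mu' mu _ [W [sW HW]] [Z1 [Z2 [cZ1 cZ2 HZ]]]].
  exists (fun=> id); split=> [k _|z z0]; first exact: subord_id.
  have FE := F_transform_ext E; split.
    by move=> k; case: k => [|[|k]]// _; rewrite FE.
  by rewrite big_nat1 addrC subrK.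
have sZ1 := class_F_subord cZ1; have sZ2 := class_F_subord cZ2.
exists (fun k => if (k <= n)%N then W k \o Z1 else Z2); split.
  move=> k kn; case: leqP => // kn'; apply: subord_comp => //; apply: sW.
  by case/andP: kn => ->.
move=> z z0; have [z1 z2 z3] := HZ _ z0.
have Z10 : 0 < Im (Z1 z) by case: sZ1 => s _ _; exact: lt_le_trans (s _ z0).
have [H1 H2] := HW _ Z10; split.
  move=> k /andP[k0 kn]; case: leqP => [kn'|nk]; first by rewrite /= H1 ?k0// z3.
  have -> : k = n.+1 by apply/eqP; rewrite eqn_leq kn.
  by rewrite z3 z2.
rewrite big_nat_recr//= ltnn z3 addrA.
rewrite (_ : \sum_(1 <= k < n.+1) _ = \sum_(1 <= k < n.+1) (W k (Z1 z) - F_transform mu' (Z1 z)));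
  last first.
  by apply: eq_big_nat => k /andP[_]; rewrite ltnS => ->.
by rewrite -H2 [LHS]z1 addrA.
Qed.

End Subordination.

(** * Truncated moments and the Cauchy transform *)

Section Concentration.
Variable R : realType.
Implicit Types (nu mu : prob R) (w z : R[i]) (t : R) (W V : R[i] -> R[i]).
Local Notation nrm := (@Normc.normc R).
Local Notation Re := (@complex.Re R).
Local Notation Im := (@complex.Im R).

Definition tail_mass nu : R := fine (nu (far 0 1)).
Definition trunc_mean nu : R := \int[nu]_(t in near 0 1) t.
Definition trunc_var nu : R := \int[nu]_(t in near 0 1) (t ^+ 2) - trunc_mean nu ^+ 2.

Lemma bmeas_near01 (p : R -> R) M : continuous p -> (forall t, `|t| < 1 -> `|p t| <= M) ->
  bmeas (fun t => p t * \1_(near 0 1) t).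
Proof.
move=> cp pM; apply: (@bmeas_indicM _ _ _ M).
- exact: measurable_near.
- exact: continuous_measurable_fun.
- by move=> t; rewrite /near /= subr0 => /pM.
Qed.

Lemma bmeas_near01_id : bmeas (fun t : R => t * \1_(near 0 1) t).
Proof. by apply: (@bmeas_near01 id 1) => [t|t t1]; [exact: cvg_id|exact: ltW]. Qed.

Lemma bmeas_near01_sqr : bmeas (fun t : R => t ^+ 2 * \1_(near 0 1) t).
Proof.
apply: (@bmeas_near01 (fun t => t ^+ 2) 1); first exact: exprn_continuous.
by move=> t t1; rewrite normrX expr_le1// ltW.
Qed.

Lemma bmeas_near01_1 : bmeas (\1_(near 0 1) : R -> R).
Proof. by apply: bmeas_indic; exact: measurable_near. Qed.

Lemma mean_near01 nu : \int[nu]_t \1_(near 0 1) t = 1 - tail_mass nu.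
Proof. by rewrite mean_indic ?prob_near//; exact: measurable_near. Qed.

Lemma indic01 (t : R) : \1_(near 0 1) t = if `|t| < 1 then 1 else 0 :> R.
Proof.
rewrite indicE; case: ifPn => h; first by rewrite mem_set// /near /= subr0.
by rewrite memNset// /near /= subr0; apply/negP.
Qed.

Lemma indic01_far (t : R) : \1_(far 0 1) t = if `|t| < 1 then 0 else 1 :> R.
Proof.
rewrite indicE; case: ifPn => h; last by rewrite mem_set// /far /= subr0 leNgt.
by rewrite memNset// /far /= subr0; apply/negP; rewrite -ltNge.
Qed.

Lemma tail_mass_ge0 nu : 0 <= tail_mass nu. Proof. exact: prob_ge0. Qed.

Lemma trunc_mean_le1 nu : `|trunc_mean nu| <= 1.
Proof.
rewrite /trunc_mean mean_on -[leRHS](mean_cst nu 1).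
apply: le_trans (le_normr_Rintegral _ _) _ => //.
  by apply: bmeas_integrable; exact: bmeas_near01_id.
apply: le_mean; [|exact: bmeas_cst|].
  have [mf [M fM]] := bmeas_near01_id; split.
    by apply: measurableT_comp => //; exact: normr_measurable.
  by exists M => t; rewrite normr_id.
move=> t; rewrite indic01 normrM; case: ifPn => h; rewrite ?normr0 ?mulr0// normr1 mulr1.
exact: ltW.
Qed.

(** Truncation loses the mass outside (-1, 1), whence the correction in this
    bias-variance identity. *)
Lemma mean_near01_sqrB nu c :
  \int[nu]_t ((t - c) ^+ 2 * \1_(near 0 1) t) =
  trunc_var nu + (trunc_mean nu - c) ^+ 2 - tail_mass nu * c ^+ 2.
Proof.
have m1 := bmeas_near01_id; have m2 := bmeas_near01_sqr; have m0 := bmeas_near01_1.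
have mZ (b : R) f : bmeas f -> bmeas (fun t => b * f t).
  by move=> mf; apply: bmeasM => //; exact: bmeas_cst.
transitivity (\int[nu]_t (t ^+ 2 * \1_(near 0 1) t - 2 * c * (t * \1_(near 0 1) t)
    + c ^+ 2 * \1_(near 0 1) t)).
  by apply: eq_Rintegral => t _; ring.
rewrite meanD; [|by apply: bmeasB => //; exact: mZ|exact: mZ].
rewrite meanB; [|exact: m2|exact: mZ].
rewrite (meanZ nu (2 * c) m1) (meanZ nu (c ^+ 2) m0) mean_near01.
by rewrite /trunc_var /trunc_mean !(mean_on _ (near 0 1)); ring.
Qed.

Lemma trunc_var_ge0 nu : 0 <= trunc_var nu.
Proof.
have : 0 <= \int[nu]_t ((t - trunc_mean nu) ^+ 2 * \1_(near 0 1) t).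
  by apply: mean_ge0 => t; rewrite mulr_ge0 ?sqr_ge0// indic01; case: ifP.
rewrite mean_near01_sqrB subrr expr0n addr0 subr_ge0; apply: le_trans.
by rewrite mulr_ge0 ?tail_mass_ge0 ?sqr_ge0.
Qed.

(** With a the truncated mean, s = t - a and u = w - a, the integrand of the left
    side is u * (u * res w t - 1) = s + s^2 * res w t. On (-1, 1) the first-order
    term integrates to a * tail_mass nu and the second-order one to at most
    trunc_var nu / Im w; off (-1, 1) the integrand is bounded crudely. It is the
    subtraction of a that makes variances appear here rather than second
    moments. *)
Lemma centred_cauchy_le nu w u : 0 < Im w -> u = w - (trunc_mean nu)%:C ->
  nrm (u * (u * cauchy_transform nu w - 1)) <=
    tail_mass nu + trunc_var nu / Im w + (nrm u + nrm u ^+ 2 / Im w) * tail_mass nu.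
Proof.
move=> w0; set a := trunc_mean nu => uE.
have mr := cbmeas_res w0; have m0 := bmeas_near01_1.
pose f t := u * (u * res w t - 1).
have mf : cbmeas f.
  by apply: cbmeasZ; apply: cbmeasB; [exact: cbmeasZ|exact: cbmeas_cst].
have -> : u * (u * cauchy_transform nu w - 1) = cmean nu f.
  rewrite cmeanZ; last by apply: cbmeasB; [exact: cbmeasZ|exact: cbmeas_cst].
  rewrite cmeanB; [|exact: cbmeasZ|exact: cbmeas_cst].
  by rewrite cmeanZ// cmean_cst.
have ms : bmeas (fun t => (t - a) * \1_(near 0 1) t).
  apply: (@bmeas_near01 (fun t => t - a) (1 + `|a|)).
    by move=> t; apply: (@continuousB _ R R id (fun=> a)) => //; exact: cst_continuous.
  by move=> t t1; rewrite (le_trans (ler_normB _ _))// lerD2r ltW.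
have ms2 : bmeas (fun t => (t - a) ^+ 2 * \1_(near 0 1) t).
  apply: (@bmeas_near01 (fun t => (t - a) ^+ 2) ((1 + `|a|) ^+ 2)).
    move=> t; apply: (@continuous_comp _ _ _ (fun t => t - a) (fun t => t ^+ 2));
      last exact: exprn_continuous.
    by apply: (@continuousB _ R R id (fun=> a)) => //; exact: cst_continuous.
  move=> t t1; rewrite normrX ler_pXn2r ?nnegrE ?addr_ge0//.
  by rewrite (le_trans (ler_normB _ _))// lerD2r ltW.
have mtail : bmeas (\1_(far 0 1) : R -> R) by apply: bmeas_indic; exact: measurable_far.
have means : \int[nu]_t ((t - a) * \1_(near 0 1) t) = a * tail_mass nu.
  transitivity (\int[nu]_t (t * \1_(near 0 1) t - a * \1_(near 0 1) t)).
    by apply: eq_Rintegral => t _; ring.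
  rewrite meanB; [|exact: bmeas_near01_id|by apply: bmeasM => //; exact: bmeas_cst].
  by rewrite (meanZ nu a m0) mean_near01 -mean_on -/(trunc_mean nu) -/a; ring.
set c := nrm u + nrm u ^+ 2 / Im w.
have c0 : 0 <= c by rewrite addr_ge0 ?nrm_ge0// divr_ge0 ?sqr_ge0// ltW.
have main : nrm (cmean nu f - (a * tail_mass nu)%:C) <= trunc_var nu / Im w + c * tail_mass nu.
  rewrite -means -cmean_real -cmeanB//; last exact: cbmeas_real.
  apply: le_trans (_ : \int[nu]_t ((Im w)^-1 * ((t - a) ^+ 2 * \1_(near 0 1) t)
      + c * \1_(far 0 1) t) <= _); last first.
    rewrite meanD; [|by apply: bmeasM => //; exact: bmeas_cst..].
    rewrite (meanZ nu _ ms2) (meanZ nu _ mtail) mean_near01_sqrB mean_indic;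
      last exact: measurable_far.
    rewrite -/a subrr expr0n addr0 lerD2r mulrC ler_wpM2r ?invr_ge0 ?(ltW w0)//.
    by rewrite gerBl mulr_ge0 ?tail_mass_ge0 ?sqr_ge0.
  apply: nrm_cmean_le.
  - by apply: cbmeasB => //; exact: cbmeas_real.
  - by apply: bmeasD; apply: bmeasM => //; exact: bmeas_cst.
  move=> t; rewrite indic01 indic01_far; case: ifPn => t1.
    rewrite !mulr1 mulr0 addr0.
    have -> : f t - (t - a)%:C = ((t - a) ^+ 2)%:C * res w t.
      rewrite rmorphXn /= !rmorphB /= /f uE /res; field; exact: subr_neq0.
    rewrite nrmM nrm_real ger0_norm ?sqr_ge0// mulrC ler_wpM2r ?sqr_ge0//.
    exact: nrm_res_le.
  rewrite !mulr0 mulr1 add0r subr0 /f nrmM /c.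
  apply: le_trans (ler_wpM2l (nrm_ge0 _) (nrmB _ _)) _.
  rewrite nrm1 nrmM mulrDr mulr1 addrC lerD2l mulrA -expr2 ler_wpM2l ?sqr_ge0//.
  exact: nrm_res_le.
rewrite -(subrK ((a * tail_mass nu)%:C) (cmean nu f)).
apply: le_trans (nrmD _ _) _; rewrite addrC -addrA; apply: lerD => //.
rewrite nrm_real normrM (ger0_norm (tail_mass_ge0 _)).
by rewrite ler_piMl ?tail_mass_ge0// trunc_mean_le1.
Qed.

(** The real part of 1 - iy G(a + iy) is the mean of
    (t - a)^2 / ((t - a)^2 + y^2), which is at least 1/2 at distance y from a. *)
Lemma far_mass_le mu a y : 0 < y ->
  fine (mu (far a y)) <= 2 * nrm ((y *i) * cauchy_transform mu (a +i* y) - 1).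
Proof.
move=> y0; set z := a +i* y; have z0 : 0 < Im z by [].
have mr := bmeas_sqr_nrm (cbmeas_res z0).
have mf : bmeas (fun t => 1 - y ^+ 2 * nrm (res z t) ^+ 2).
  by apply: bmeasB; [exact: bmeas_cst|apply: bmeasM => //; exact: bmeas_cst].
have E : Re (1 - (y *i) * cauchy_transform mu z) =
    \int[mu]_t (1 - y ^+ 2 * nrm (res z t) ^+ 2).
  rewrite meanB; [|exact: bmeas_cst|by apply: bmeasM => //; exact: bmeas_cst].
  by rewrite mean_cst meanZ// ReD ReN ReM Im_cauchy//=; ring.
have n2 t : nrm (res z t) ^+ 2 = ((t - a) ^+ 2 + y ^+ 2)^-1.
  by rewrite nrmV exprVn sqr_nrm ReD ImD ReN ImN /=; congr (_^-1); ring.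
have pos t : 0 < (t - a) ^+ 2 + y ^+ 2 by rewrite ltr_wpDl ?sqr_ge0// exprn_gt0.
rewrite mulrC -ler_pdivrMr// mulrC.
apply: le_trans (_ : Re (1 - (y *i) * cauchy_transform mu z) <= _); last first.
  by apply: le_trans (ler_norm _) _; rewrite nrm_distC Re_le_nrm.
rewrite E; apply: prob_le_mean => //; first exact: measurable_far.
  move=> t; rewrite n2 subr_ge0 ler_pdivrMr// mul1r lerDr sqr_ge0 //.
move=> t; rewrite /far /= n2 => yt.
have yt2 : y ^+ 2 <= (t - a) ^+ 2.
  by rewrite -(real_normK (num_real (t - a))) ler_pXn2r// nnegrE ?(ltW y0).
rewrite lerBrDr addrC -lerBrDr ler_pdivrMr//.
move: yt2; set p := _ ^+ 2; set q := _ ^+ 2; lra.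
Qed.

Lemma ccontM W V : ccont W -> ccont V -> ccont (fun z => W z * V z).
Proof.
move=> cW cV z z0 e e0.
have p1 : 0 < nrm (V z) + 1 by rewrite ltr_wpDl ?nrm_ge0.
have p2 : 0 < nrm (W z) + 1 by rewrite ltr_wpDl ?nrm_ge0.
have e1 : 0 < e / 2 / (nrm (V z) + 1) by rewrite !divr_gt0.
have e2 : 0 < Num.min 1 (e / 2 / (nrm (W z) + 1 + e / 2 / (nrm (V z) + 1))).
  by rewrite lt_min ltr01 !divr_gt0// addr_gt0.
have [d d0 H] := cW _ z0 _ e1; have [d' d'0 H'] := cV _ z0 _ e2.
exists (Num.min d d'); first by rewrite lt_min d0.
move=> z' z'0; rewrite lt_min => /andP[/(H _ z'0) h /(H' _ z'0)].
rewrite lt_min => /andP[_ h'].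
have -> : W z' * V z' - W z * V z = (W z' - W z) * V z + W z' * (V z' - V z) by ring.
apply: le_lt_trans (nrmD _ _) _; rewrite !nrmM (splitr e); apply: ler_ltD.
  apply: le_trans (_ : e / 2 / (nrm (V z) + 1) * (nrm (V z) + 1) <= _).
    by apply: ler_pM; rewrite ?nrm_ge0 ?(ltW h)// lerDl.
  by rewrite divfK// gt_eqF.
set m := e / 2 / (nrm (V z) + 1) in h e1 h' *.
have pm : 0 < nrm (W z) + 1 + m by rewrite addr_gt0.
have Wz' : nrm (W z') <= nrm (W z) + 1 + m.
  by rewrite -(subrK (W z) (W z')) (le_trans (nrmD _ _))//; lra.
apply: le_lt_trans (ler_wpM2r (nrm_ge0 _) Wz') _.
by rewrite mulrC -ltr_pdivlMr.
Qed.

Lemma ccontB_cst W c : ccont W -> ccont (fun z => W z - c).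
Proof.
move=> cW z z0 e e0; have [d d0 H] := cW _ z0 _ e0; exists d => // z' z'0 /(H _ z'0).
by rewrite opprB addrA subrK.
Qed.

Lemma ccont_vertical V a y : ccont V -> 0 < y ->
  {for y, continuous (fun y => nrm (V (a +i* y)))}.
Proof.
move=> cV y0; apply/cvgrPdist_lt => e e0.
have [d d0 H] := cV (a +i* y) y0 _ e0.
have d'0 : 0 < Num.min d y by rewrite lt_min d0.
exists (Num.min d y) => // x; rewrite /ball_ /= lt_min => /andP[xd xy].
have x0 : 0 < x by move: xy; rewrite ltr_norml => /andP[]; lra.
have xd' : nrm ((a +i* x) - (a +i* y)) < d.
  rewrite (_ : _ - _ = (x - y)*i) ; last by apply: complex_ext; rewrite /= ?subrr.
  by rewrite /= expr0n add0r sqrtr_sqr distrC.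
have := H (a +i* x) x0 xd'; apply: le_lt_trans.
rewrite ler_norml; apply/andP; split.
  by rewrite lerNl opprB nrm_sub_ge.
by rewrite nrm_distC nrm_sub_ge.
Qed.

Lemma cvg_sum_nat (T : Type) (F : set_system T) {FF : Filter F} (f : nat -> T -> R)
    (l : nat -> R) n :
  (forall k, (0 < k <= n)%N -> f k x @[x --> F] --> l k) ->
  (\sum_(1 <= k < n.+1) f k x) @[x --> F] --> \sum_(1 <= k < n.+1) l k.
Proof.
elim: n => [|n IH] H.
  rewrite big_geq//; under eq_fun do rewrite big_geq//; exact: cvg_cst.
rewrite big_nat_recr//; under eq_fun do rewrite big_nat_recr//=.
apply: cvgD; last by apply: H; rewrite ltnSn.
by apply: IH => k /andP[k0 kn]; apply: H; rewrite k0 leqW.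
Qed.

End Concentration.

(** * Concentration of a free convolution *)

Section FreeConcentration.
Variable R : realType.
Implicit Types (mu : prob R) (w z : R[i]) (t : R).
Local Notation nrm := (@Normc.normc R).
Local Notation Re := (@complex.Re R).
Local Notation Im := (@complex.Im R).

(** The point moves along the vertical line through a, the expected centre of
    mu. The quantities d k measure how far each F_{nu k} is, at its own
    subordinated point, from the reciprocal Cauchy transform of a point mass at
    the truncated mean. *)
Section Configuration.
Variables (nu : nat -> prob R) (n : nat) (mu : prob R) (W : nat -> R[i] -> R[i]).
Hypothesis sW : forall k, (0 < k <= n)%N -> subord (W k).
Hypothesis FW : forall z, 0 < Im z -> forall k, (0 < k <= n)%N ->
  F_transform (nu k) (W k z) = F_transform mu z.
Hypothesis sumW : forall z, 0 < Im z ->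
  z = F_transform mu z + \sum_(1 <= k < n.+1) (W k z - F_transform mu z).

Let a := \sum_(1 <= k < n.+1) trunc_mean (nu k).
Let eta := \sum_(1 <= k < n.+1) (tail_mass (nu k) + trunc_var (nu k)).
Let d k z := (W k z - (trunc_mean (nu k))%:C) * cauchy_transform mu z - 1.
Let H y := \sum_(1 <= k < n.+1) nrm (d k (a +i* y)).

(** Multiplying the subordination equation by G = 1 / F. *)
Lemma sum_dE y : 0 < y ->
  (y *i) * cauchy_transform mu (a +i* y) - 1 = \sum_(1 <= k < n.+1) d k (a +i* y).
Proof.
move=> y0; set z := a +i* y; set G := cauchy_transform mu z.
have FG : F_transform mu z * G = 1 by exact: F_cauchy.
have -> : y *i = z - a%:C by apply: complex_ext; rewrite /= ?subrr// subr0.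
have -> : z - a%:C = F_transform mu z + \sum_(1 <= k < n.+1)
   (W k z - F_transform mu z - (trunc_mean (nu k))%:C).
  by rewrite [in RHS]sumrB addrA -(sumW (z := z))// /a (raddf_sum (real_complex R)).
rewrite mulrDl FG addrAC subrr add0r mulr_suml.
by apply: eq_bigr => k _; rewrite /d -/G -FG; ring.
Qed.

(** If the total deviation is at most 1/2, then F and u = W k z - trunc_mean (nu k)
    are comparable to y, so that [centred_cauchy_le] applies with |u| between y
    and 3y and improves the bound on the deviation. *)
Lemma d_le (y0 y : R) k : 0 < y0 -> y0 < 1 -> y0 <= y -> H y <= 2^-1 -> (0 < k <= n)%N ->
  nrm (d k (a +i* y)) <= 5 * (tail_mass (nu k) + trunc_var (nu k)) / y0 ^+ 2.
Proof.
move=> y00 y01 y0y Hy kn; have y_gt0 : 0 < y by exact: lt_le_trans y0y.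
set z := a +i* y; have z0 : 0 < Im z by [].
set w := W k z; set F := F_transform mu z; set G := cauchy_transform mu z.
have [/(_ _ z0) Imw _ _] := sW kn; rewrite -/w /= in Imw.
have w0 : 0 < Im w by exact: lt_le_trans Imw.
have FG : F * G = 1 by exact: F_cauchy.
have FGn : nrm F * nrm G = 1 by rewrite -nrmM FG nrm1.
have GE : cauchy_transform (nu k) w = G.
  by apply: invr_inj; exact: (FW z0 kn).
set u := w - (trunc_mean (nu k))%:C.
have := @centred_cauchy_le R (nu k) w u w0 erefl; rewrite GE.
have -> : d k z = u * G - 1 by [].
set e := tail_mass _; set v := trunc_var _; set D := u * G - 1.
have e0 : 0 <= e := tail_mass_ge0 _; have v0 : 0 <= v := trunc_var_ge0 _.
have Imu : y <= Im u by rewrite /u Im_subr.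
have nu_ge : y <= nrm u by exact: le_trans (le_Im_nrm _).
have dk : nrm D <= 2^-1.
  apply: le_trans Hy; rewrite /H (bigD1_seq k) ?iota_uniq//=; last first.
    by rewrite mem_index_iota ltnS.
  by rewrite -/z lerDl sumr_ge0// => i _; exact: nrm_ge0.
have nF : nrm F <= 2 * y.
  have s : nrm ((y *i) * G - 1) <= 2^-1.
    rewrite sum_dE//; exact: le_trans (nrm_sum _ _ _) Hy.
  have := nrm_sub_ge 1 ((y *i) * G); rewrite nrm1 nrm_distC nrmM => h.
  have yi : nrm (y *i) = y by rewrite /= expr0n add0r sqrtr_sqr ger0_norm// ltW.
  rewrite yi in h.
  have : nrm F * 2^-1 <= nrm F * (y * nrm G) by rewrite ler_wpM2l ?nrm_ge0//; lra.
  by rewrite mulrCA FGn mulr1; lra.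
have nu_le : nrm u <= 3 * y.
  have uE : u = F * (1 + D) by rewrite /D addrC subrK mulrCA FG mulr1.
  rewrite uE nrmM; apply: le_trans (_ : 2 * y * (3 / 2) <= _); last by lra.
  apply: ler_pM => //; rewrite ?nrm_ge0//.
  by apply: le_trans (nrmD _ _) _; rewrite nrm1; lra.
have u0 : 0 < nrm u by exact: lt_le_trans nu_ge.
rewrite nrmM => main.
rewrite -(ler_pM2l u0); apply: le_trans main _.
have Imw_inv : (Im w)^-1 <= y^-1 by rewrite lef_pV2 ?posrE.
have y0i : 1 <= y0 ^- 2 by rewrite invf_ge1 ?exprn_gt0// exprn_ile1// ltW.
have uy1 : 1 <= nrm u / y by rewrite ler_pdivlMr// mul1r.
have y0sq : y0 ^+ 2 <= y0 by rewrite expr2 ger_pMl// ltW.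
have uy0 : nrm u / y <= nrm u / y0 ^+ 2.
  rewrite ler_wpM2l ?nrm_ge0// lef_pV2 ?posrE ?exprn_gt0//; exact: le_trans y0y.
(* Each error term is compared with |u| / y0 ^ 2, which is at least 1. *)
have t1 : e <= e * (nrm u / y0 ^+ 2) by rewrite ler_peMr// (le_trans uy1).
have t2 : v / Im w <= v * (nrm u / y0 ^+ 2).
  rewrite ler_wpM2l//; apply: le_trans Imw_inv _.
  rewrite -[leLHS]div1r ler_pdivrMr// mulrAC ler_pdivlMr ?exprn_gt0// mul1r.
  by rewrite expr2 ler_pM// ?(ltW y00)// (le_trans y0y).
have t3 : (nrm u + nrm u ^+ 2 / Im w) * e <= 4 * e * (nrm u / y0 ^+ 2).
  rewrite [leLHS]mulrC -mulrA mulrCA ler_wpM2l//.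
  have h : nrm u ^+ 2 / Im w <= 3 * nrm u.
    apply: le_trans (ler_wpM2l (sqr_ge0 _) Imw_inv) _.
    by rewrite ler_pdivrMr// expr2 [leRHS]mulrAC ler_pM2r.
  apply: le_trans (_ : 4 * nrm u <= _); first by lra.
  by rewrite ler_wpM2l// ler_peMr ?nrm_ge0.
rewrite [leRHS](_ : _ = e * (nrm u / y0 ^+ 2) + 4 * e * (nrm u / y0 ^+ 2) +
   5 * (v * (nrm u / y0 ^+ 2))); last by ring.
have : 0 <= v * (nrm u / y0 ^+ 2) by rewrite mulr_ge0// divr_ge0 ?nrm_ge0 ?sqr_ge0.
lra.
Qed.

Lemma ccont_d k : (0 < k <= n)%N -> ccont (d k).
Proof.
move=> /sW[_ cW _]; apply: ccontB_cst; apply: ccontM; last exact: ccont_cauchy.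
exact: ccontB_cst.
Qed.

Lemma H_continuous y : 0 < y -> {for y, continuous H}.
Proof. by move=> y0; apply: cvg_sum_nat => k /ccont_d ck; exact: ccont_vertical. Qed.

(** Far up on the line, G(z) ~ 1 / z and W k z ~ z. *)
Lemma H_pinfty : H y @[y --> +oo] --> 0.
Proof.
rewrite -[X in _ --> X](_ : \sum_(1 <= k < n.+1) 0 = _); last by rewrite big1.
apply: cvg_sum_nat => k kn; have [W1 _ W3] := sW kn.
apply/cvgrPdist_le => e e0; have e3 : 0 < e / 3 by rewrite divr_gt0.
have [Y Y0 HY] := W3 2 _ (ler1n _ 2) e3.
have [Y' Y'0 HY'] := asymp_cauchy mu (ler1n _ 2) e3.
set m := trunc_mean (nu k).
have big : \forall y \near +oo, [/\ Y <= y, Y' <= y, `|a| <= y & `|m| * 3 / e <= y].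
  by near=> y; split; near: y; apply: nbhs_pinfty_ge; exact: num_real.
near=> y; have [yY yY' ya ym] : [/\ Y <= y, Y' <= y, `|a| <= y & `|m| * 3 / e <= y].
  by near: y.
have y0 : 0 < y by exact: lt_le_trans yY.
set z := a +i* y; have z0 : 0 < Im z by [].
have za : nrm z <= 2 * Im z.
  apply: le_trans (nrm_le_ReIm _) _; rewrite /= (ger0_norm (ltW y0)); lra.
have h1 := HY z yY za; have h2 := HY' z yY' za.
set G := cauchy_transform mu z in h2.
have nG : nrm G <= y^-1 by exact: nrm_cauchy_le.
rewrite sub0r normrN ger0_norm ?nrm_ge0//.
have -> : d k z = (z * G - 1) + (W k z - z) * G - m%:C * G by rewrite /d -/G; ring.
have t2 : nrm ((W k z - z) * G) <= e / 3.
  rewrite nrmM; apply: le_trans (ler_pM (nrm_ge0 _) (nrm_ge0 _) h1 nG) _.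
  by rewrite /= mulfK// gt_eqF.
have t3 : nrm (m%:C * G) <= e / 3.
  rewrite nrmM nrm_real; apply: le_trans (ler_wpM2l _ nG) _ => //.
  move: ym; rewrite !ler_pdivrMr// => ym; lra.
have := nrmB (z * G - 1 + (W k z - z) * G) (m%:C * G).
have := nrmD (z * G - 1) ((W k z - z) * G).
lra.
Unshelve. all: by end_near. Qed.

(** A continuity argument: H is small near infinity, and by [d_le] it cannot take
    the value 1/2 at any height y >= y0, so that it remains below 1/2 all the way
    down to y0. Without it nothing would exclude that some W k z sits near a far
    atom of nu k, where the tail contribution to d k is not small. *)
Lemma H_le y0 : 0 < y0 -> y0 < 1 -> 10 * eta <= y0 ^+ 3 ->
  H y0 <= 5 * eta / y0 ^+ 2.
Proof.
move=> y00 y01 hy0.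
have improve y : y0 <= y -> H y <= 2^-1 -> H y <= 5 * eta / y0 ^+ 2.
  move=> y0y Hy; rewrite /eta mulr_sumr mulr_suml /H ler_sum_nat// => k.
  by rewrite ltnS => kn; exact: d_le.
have small : 5 * eta / y0 ^+ 2 < 2^-1.
  rewrite ltr_pdivrMr ?exprn_gt0//; move: hy0; rewrite exprS.
  have : y0 * y0 ^+ 2 < y0 ^+ 2 by rewrite gtr_pMl// exprn_gt0.
  lra.
apply: (improve y0) => //; rewrite leNgt; apply/negP => Hy0.
have [y1 y01' Hy1] : exists2 y1, y0 <= y1 & H y1 <= 2^-1.
  have h2 : 0 < 2^-1 :> R by rewrite invr_gt0.
  have /cvgrPdist_le/(_ _ h2) near1 := H_pinfty.
  have [y [yy0 Hy]] : exists y, y0 <= y /\ `|0 - H y| <= 2^-1.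
    apply: (@filter_ex _ (+oo : set_system R)); near=> y; split; near: y => //.
    by apply: nbhs_pinfty_ge; exact: num_real.
  exists y => //; apply: le_trans Hy.
  by rewrite sub0r normrN ler_norm.
have cH : {within `[y0, y1], continuous H}.
  apply: continuous_in_subspaceT => y; rewrite inE /= in_itv /= => /andP[y0y _].
  by apply: H_continuous; exact: lt_le_trans y0y.
have [|y yI Hy] := @IVT _ _ _ _ (2^-1) y01' cH.
  by rewrite ge_min le_max Hy1 (ltW Hy0) orbT.
move: yI; rewrite in_itv /= => /andP[y0y _].
have := improve y y0y; rewrite Hy => /(_ (lexx _)).
by rewrite leNgt small.
Unshelve. all: by end_near. Qed.

End Configuration.

(** The quantitative form of the sufficiency: the truncated means add up, and the
    tails and truncated variances, not the truncated second moments, control the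
    deviation from their sum. *)
Lemma free_conv_concentration (nu : nat -> prob R) n mu y :
  is_free_conv_upto nu n mu -> 0 < y -> y < 1 ->
  10 * \sum_(1 <= k < n.+1) (tail_mass (nu k) + trunc_var (nu k)) <= y ^+ 3 ->
  fine (mu (far (\sum_(1 <= k < n.+1) trunc_mean (nu k)) y)) <= y.
Proof.
move=> /free_conv_subordination[W [sW HW]] y0 y1 hy.
have FW z (z0 : 0 < Im z) := (HW z z0).1; have sumW z (z0 : 0 < Im z) := (HW z z0).2.
apply: le_trans (far_mass_le _ _ y0) _; rewrite (sum_dE nu sumW y0).
apply: le_trans (_ : 2 *
    (5 * (\sum_(1 <= k < n.+1) (tail_mass (nu k) + trunc_var (nu k))) / y ^+ 2) <= _).
  rewrite ler_pM2l//; apply: le_trans (nrm_sum _ _ _) _.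
  exact: (H_le sW FW sumW y0 y1 hy).
by rewrite mulrA mulrA -natrM ler_pdivrMr ?exprn_gt0// -exprS.
Qed.

End FreeConcentration.

(** * The Levy distance to the point mass at 0 *)

Section Levy.
Variable R : realType.
Implicit Types (mu : prob R) (h x : R).

(** The set whose infimum is [levy mu (delta0 R)]. *)
Definition levy_set mu : set R := [set h : R | forall x : R,
  fine (mu `]-oo, (x - h)[%classic) - h <= fine (delta0 R `]-oo, x[%classic) /\
  fine (delta0 R `]-oo, x[%classic) <= fine (mu `]-oo, (x + h)[%classic) + h].

Lemma delta0_ray x : fine (delta0 R `]-oo, x[%classic) = if 0 < x then 1 else 0.
Proof.
rewrite /delta0 /= /dirac /= indicE; case: ifPn => h.
  by rewrite mem_set//= in_itv.
by rewrite memNset//= in_itv /=; apply/negP.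
Qed.

Lemma measurable_ray x : measurable (`]-oo, x[%classic : set (measurableTypeR R)).
Proof. exact: measurable_itv. Qed.

Lemma levy_set_ge0 mu h : levy_set mu h -> 0 <= h.
Proof.
move=> /(_ 0)[+ _]; rewrite delta0_ray ltxx subr_le0; apply: le_trans; exact: prob_ge0.
Qed.

Lemma levy_set1 mu : levy_set mu 1.
Proof.
move=> x; have p y := prob_le1 mu (measurable_ray y).
have q y := prob_ge0 mu `]-oo, y[%classic.
rewrite delta0_ray; case: ifP => _; split; have := p (x - 1); have := q (x + 1); lra.
Qed.

Lemma levy_ge0 mu : 0 <= levy mu (delta0 R).
Proof. by apply: lb_le_inf; [exists 1; exact: levy_set1 | move=> h /levy_set_ge0]. Qed.

Lemma levy_le mu h : levy_set mu h -> levy mu (delta0 R) <= h.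
Proof. by move=> hS; apply: ge_inf => //; exists 0 => y /levy_set_ge0. Qed.

Lemma levy_le1 mu : levy mu (delta0 R) <= 1.
Proof. exact/levy_le/levy_set1. Qed.

Lemma levy_le_far mu a y : 0 < y -> fine (mu (far a y)) <= y ->
  levy mu (delta0 R) <= `|a| + y.
Proof.
move=> y0 muy; apply: levy_le => x; rewrite delta0_ray.
have h0 : y <= `|a| + y by rewrite lerDr.
have [na pa] : a <= `|a| /\ - a <= `|a| by rewrite -{2}normrN !ler_norm.
case: ifPn => [x0|]; last rewrite -leNgt => x0; split.
- by have := prob_le1 mu (measurable_ray (x - (`|a| + y))); move: h0 y0; lra.
- have : fine (mu (~` `]-oo, (x + (`|a| + y))[%classic)) <= y.
    apply: le_trans muy; apply: prob_mono.
    + by apply: measurableC; exact: measurable_ray.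
    + exact: measurable_far.
    + move=> t /=; rewrite in_itv /= => /negP; rewrite -leNgt /far /= => xt.
      apply: le_trans (ler_norm _); move: xt x0 na; lra.
  rewrite prob_setC; last exact: measurable_ray.
  move: h0; lra.
- have : fine (mu `]-oo, (x - (`|a| + y))[%classic) <= y.
    apply: le_trans muy; apply: prob_mono.
    + exact: measurable_ray.
    + exact: measurable_far.
    + move=> t /=; rewrite in_itv /= /far /= distrC => xt.
      apply: le_trans (ler_norm _); move: xt x0 pa; lra.
  move: h0; lra.
- by rewrite addr_ge0 ?prob_ge0// addr_ge0// ltW.
Qed.

Lemma far_le_levy mu h : levy mu (delta0 R) < h -> fine (mu (far 0 h)) <= 2 * h.
Proof.
move=> lh.
have [h' h'S h'h] : exists2 h', levy_set mu h' & h' < h.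
  by apply: inf_lt => //; exists 1; exact: levy_set1.
have h'0 := levy_set_ge0 h'S.
have [+ _] := h'S 0; have [_] := h'S (h - h').
rewrite !delta0_ray ltxx subr_gt0 h'h subrK sub0r => up low.
have cover : far 0 h `<=` `]-oo, (- h')[%classic `|` ~` `]-oo, h[%classic.
  move=> t /=; rewrite /far /= subr0 !in_itv /= => ht.
  have [th|th] := ltP t h; last by right.
  by left; move: ht; case: (ger0P (t : R)) => t0 ht; lra.
have mr := measurable_ray.
have mr' := measurableC (mr h).
apply: le_trans (prob_mono mu (measurable_far 0 h) (measurableU _ _ (mr _) mr') cover) _.
apply: le_trans (prob_setU mu (mr _) mr') _.
rewrite prob_setC//; move: up low h'h; lra.
Qed.

End Levy.

(** * Rescaling *)

Section Rescaling.
Variable R : realType.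
Implicit Types (mu nu : prob R) (f : R -> R).

Lemma rescale_set n mu (A : set (measurableTypeR R)) :
  rescale n mu A = mu [set x : R | A (x / n%:R)].
Proof. by []. Qed.

Lemma bmeas_scale n f : bmeas f -> bmeas (fun x => f (x / n%:R)).
Proof.
case=> mf [M fM]; split; last by exists M => t.
apply: (measurableT_comp mf); exact: measurable_div_by.
Qed.

Lemma mean_rescale n mu f : bmeas f ->
  \int[rescale n mu]_t f t = \int[mu]_x f (x / n%:R).
Proof.
move=> mf; rewrite /Rintegral /rescale /distribution integral_pushforward//.
- by apply/measurable_EFinP; exact: mf.1.
- rewrite preimage_setT.
  by apply: (@bmeas_integrable _ mu (fun x => f (x / n%:R))); exact: bmeas_scale.
Qed.

Lemma far_rescale n mu a r : (0 < n)%N ->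
  fine (rescale n mu (far a r)) = fine (mu (far (n%:R * a) (n%:R * r))).
Proof.
move=> n0; rewrite rescale_set; congr (fine (mu _)); apply/seteqP.
have n1 : 0 < n%:R :> R by rewrite ltr0n.
have E (t : R) : (r <= `|t / n%:R - a|) = (n%:R * r <= `|t - n%:R * a|).
  have -> : t / n%:R - a = (t - n%:R * a) / n%:R by field; rewrite gt_eqF.
  by rewrite normrM normfV (gtr0_norm n1) ler_pdivlMr// mulrC.
by split=> t; rewrite /far /= E.
Qed.

Lemma tail_mass_rescale n mu : (0 < n)%N ->
  tail_mass (rescale n mu) = fine (mu [set x | n%:R <= `|x|]).
Proof.
move=> n0; rewrite /tail_mass far_rescale// mulr0 mulr1; congr (fine (mu _)).
by apply/seteqP; split => t; rewrite /far /= subr0.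
Qed.

Lemma trunc_moment_rescale n mu j : (0 < n)%N ->
  \int[rescale n mu]_(t in near 0 1) (t ^+ j) =
  (n%:R ^+ j)^-1 * \int[mu]_(x in `](- n%:R), n%:R[%classic) (x ^+ j).
Proof.
move=> n0; have n1 : 0 < n%:R :> R by rewrite ltr0n.
rewrite mean_on mean_rescale; last first.
  apply: (@bmeas_near01 _ (fun t => t ^+ j) 1); first exact: exprn_continuous.
  by move=> t t1; rewrite normrX exprn_ile1// ltW.
rewrite (mean_on mu `](- n%:R), n%:R[%classic) -meanZ; last first.
  apply: (@bmeas_indicM _ _ _ (n%:R ^+ j)); first exact: measurable_itv.
    by apply: continuous_measurable_fun; exact: exprn_continuous.
  move=> t /=; rewrite in_itv /= -ltr_norml normrX => tn.
  by apply: lerXn2r; rewrite ?nnegrE// ltW.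
apply: eq_Rintegral => t _; rewrite expr_div_n indic01 normrM normfV.
rewrite (gtr0_norm n1) ltr_pdivrMr// mul1r indicE.
rewrite (_ : (t \in _) = (`|t| < n%:R)); last first.
  by apply/idP/idP; rewrite inE /= in_itv /= ltr_norml.
by case: ifP => _; rewrite ?mulr1 ?mulr0// mulrC.
Qed.

Lemma trunc_mean_rescale n mu : (0 < n)%N -> trunc_mean (rescale n mu) =
  n%:R^-1 * \int[mu]_(x in `](- n%:R), n%:R[%classic) x.
Proof. exact: (@trunc_moment_rescale n mu 1). Qed.

Lemma trunc_var_rescale n mu : (0 < n)%N -> trunc_var (rescale n mu) =
  (n%:R ^+ 2)^-1 * (\int[mu]_(x in `](- n%:R), n%:R[%classic) (x ^+ 2)
     - (\int[mu]_(x in `](- n%:R), n%:R[%classic) x) ^+ 2).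
Proof.
move=> n0; rewrite /trunc_var trunc_moment_rescale// trunc_mean_rescale//.
by rewrite exprMn exprVn mulrBr.
Qed.

Lemma eta1E (mu : nat -> prob R) n : (0 < n)%N ->
  eta1 mu n = \sum_(1 <= k < n.+1) tail_mass (rescale n (mu k)).
Proof. by move=> n0; apply: eq_bigr => k _; rewrite tail_mass_rescale. Qed.

Lemma eta2E (mu : nat -> prob R) n : (0 < n)%N ->
  eta2 mu n = \sum_(1 <= k < n.+1) trunc_mean (rescale n (mu k)).
Proof.
by move=> n0; rewrite /eta2 mulr_sumr; apply: eq_bigr => k _; rewrite trunc_mean_rescale.
Qed.

Lemma eta3E (mu : nat -> prob R) n : (0 < n)%N ->
  eta3 mu n = \sum_(1 <= k < n.+1) trunc_var (rescale n (mu k)).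
Proof.
by move=> n0; rewrite /eta3 mulr_sumr; apply: eq_bigr => k _; rewrite trunc_var_rescale.
Qed.

Lemma eta1_ge0 (mu : nat -> prob R) n : 0 <= eta1 mu n.
Proof. by apply: sumr_ge0 => k _; exact: prob_ge0. Qed.

Lemma eta3_ge0 (mu : nat -> prob R) n : (0 < n)%N -> 0 <= eta3 mu n.
Proof. by move=> n0; rewrite eta3E//; apply: sumr_ge0 => k _; exact: trunc_var_ge0. Qed.

End Rescaling.

(** * The rate of convergence and the sufficiency *)

Section UpperBound.
Variable R : realType.
Variables (mu mun : nat -> prob R).
Hypothesis freemu : forall n : nat, (0 < n)%N ->
  is_free_conv_upto (fun k => rescale n (mu k)) n (mun n).

(** Splitting off the location eta2, the concentration is governed by eta1 and
    eta3 alone; this is why eta2 enters the final estimate linearly. *)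
Lemma far_eta2_le n y : (0 < n)%N -> 0 < y -> y < 1 ->
  10 * (eta1 mu n + eta3 mu n) <= y ^+ 3 -> fine (mun n (far (eta2 mu n) y)) <= y.
Proof.
move=> n0 y0 y1 hy; rewrite eta2E//.
apply: (free_conv_concentration (freemu n0)) => //.
by rewrite big_split /= -eta1E// -eta3E.
Qed.

Lemma levy_le_eta n y : (0 < n)%N -> 0 < y -> y < 1 ->
  10 * (eta1 mu n + eta3 mu n) <= y ^+ 3 ->
  levy (mun n) (delta0 R) <= `|eta2 mu n| + y.
Proof. by move=> n0 y0 y1 hy; apply: levy_le_far => //; exact: far_eta2_le. Qed.

(** Writing x for the sixth root of eta1 + eta3, one may take y slightly above 3x
    in [levy_le_eta] as soon as 3x < 1, because 10 * x^6 <= (3x)^3; in the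
    remaining case the distance is at most 1 anyway. *)
Lemma levy_rate n : (0 < n)%N -> levy (mun n) (delta0 R) <=
  3 * ((eta1 mu n + eta3 mu n) `^ 6%:R^-1 + `|eta2 mu n|).
Proof.
move=> n0; set e := eta1 mu n + eta3 mu n; set x := e `^ 6%:R^-1.
have e0 : 0 <= e by rewrite addr_ge0 ?eta1_ge0 ?eta3_ge0.
have x0 : 0 <= x by exact: powR_ge0.
have xe : x ^+ 6 = e by rewrite -powR_mulrn// -powRrM mulVf// powRr1.
apply: le_trans (_ : `|eta2 mu n| + 3 * x <= _); last first.
  by rewrite mulrDr addrC lerD2l ler_peMl// ler1n.
apply/ler_addgt0Pr => d d0; have [h|h] := ltP (3 * x + d) 1; last first.
  apply: le_trans (levy_le1 _) _; rewrite -addrA; apply: le_trans h _.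
  by rewrite lerDr.
rewrite -addrA; apply: levy_le_eta => //; first by rewrite ltr_wpDl// mulr_ge0.
apply: le_trans (_ : (3 * x) ^+ 3 <= _); last first.
  by rewrite ler_pXn2r ?nnegrE ?addr_ge0 ?mulr_ge0 ?lerDl// ltW.
have x1 : x < 1 by lra.
rewrite -/e -xe exprMn (exprD x 3 3) mulrA ler_wpM2r ?exprn_ge0//.
have : x ^+ 3 <= 1 by rewrite exprn_ile1// ltW.
lra.
Qed.

Lemma levy_cvg0 : eta1 mu @ \oo --> (0 : R) -> eta2 mu @ \oo --> (0 : R) ->
  eta3 mu @ \oo --> (0 : R) -> levy (mun n) (delta0 R) @[n --> \oo] --> (0 : R).
Proof.
move=> c1 c2 c3; apply/cvgrPdist_le => e e0.
have [y [y0 y1 ye]] : exists y, [/\ 0 < y, y < 1 & y <= e / 2].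
  exists (Num.min (e / 2) (2^-1)).
  rewrite lt_min gt_min ge_min lexx divr_gt0 ?invr_gt0 ?ltr0n//; split=> //.
  by apply/orP; right; lra.
have d0 : 0 < y ^+ 3 / 20 by rewrite divr_gt0// exprn_gt0.
have e2 : 0 < e / 2 by rewrite divr_gt0.
have /cvgrPdist_le/(_ _ d0) h1 := c1.
have /cvgrPdist_le/(_ _ d0) h3 := c3.
have /cvgrPdist_le/(_ _ e2) h2 := c2.
near=> n; have n0 : (0 < n)%N by near: n; exists 1%N.
rewrite sub0r normrN ger0_norm ?levy_ge0//.
have k1 : `|0 - eta1 mu n| <= y ^+ 3 / 20 by near: n.
have k2 : `|0 - eta2 mu n| <= e / 2 by near: n.
have k3 : `|0 - eta3 mu n| <= y ^+ 3 / 20 by near: n.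
move: k1 k2 k3; rewrite !sub0r !normrN => k1 k2 k3.
apply: le_trans (_ : `|eta2 mu n| + y <= _); last by lra.
apply: levy_le_eta => //.
have := le_trans (ler_norm _) k1; have := le_trans (ler_norm _) k3; lra.
Unshelve. all: by end_near. Qed.

End UpperBound.

(** * Centres of the summands *)

Section Centring.
Variable R : realType.
Implicit Types (mu nu : prob R) (w z : R[i]) (t b q : R).
Local Notation nrm := (@Normc.normc R).
Local Notation Re := (@complex.Re R).
Local Notation Im := (@complex.Im R).

(** In this sense nu is a perturbation of cost q of the point mass at b. The cost
    bounds second-order quantities, and the third clause says that b is accurate
    to the same order q, rather than to the order sqrt q that the second clause
    gives: it is this accuracy that survives summation over the summands. The
    last clause concerns the truncation around 0, and is meant for a centre b well
    inside (-1, 1). *)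
Definition centred nu b q := [/\ 0 <= q,
  forall r, 0 < r -> r <= 1 -> r ^+ 2 * fine (nu (far b r)) <= 9 * q,
  `|\int[nu]_t ((t - b) * \1_(near b 1) t)| <= 6 * q &
  `|b| <= 2^-1 -> \int[nu]_t ((t - b) ^+ 2 * \1_(near 0 1) t) <= 21 * q].

Lemma bmeas_centred b : bmeas (fun t => (t - b) * \1_(near b 1) t).
Proof.
apply: (@bmeas_indicM _ _ _ 1); first exact: measurable_near.
  apply: continuous_measurable_fun => t.
  by apply: (@continuousB _ R R id (fun=> b)) => //; exact: cst_continuous.
by move=> t; rewrite /near /= => /ltW.
Qed.

(** The centre is the real part of c = w - F. By definition of the deviation,
    t - c = dev t * (w - t) = dev t * (F - (t - c)), so |t - c| is at most
    |dev t| * (2 + |t - c|) and a point t far from c has a large |dev t|. For the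
    third clause, the same relation gives t - c = F * dev t - dev t ^ 2 * (w - t),
    whose first term integrates to 0. *)
Lemma subordination_centred nu w : 1 <= Im w -> nrm (F_transform nu w) <= 2 ->
  Im (F_transform nu w) - Im w <= 1 ->
  centred nu (Re (w - F_transform nu w)) (defect nu w).
Proof.
move=> w1; have w0 : 0 < Im w by exact: lt_le_trans w1.
set F := F_transform nu w => F2 Fw1; set c := w - F; set b := Re c.
set q := defect nu w.
have cI : `|Im c| <= 1.
  rewrite /c ImD ImN distrC ger0_norm// subr_ge0; exact: Im_F_ge.
have mD := cbmeas_dev nu w0; have mD2 := bmeas_sqr_nrm mD.
have devE t : t%:C - c = dev nu w t * (w - t%:C).
  rewrite /dev -/F /res /c; field; exact: subr_neq0.
have wt t : w - t%:C = F - (t%:C - c) by rewrite /c; ring.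
have tb t : `|t - b| <= nrm (t%:C - c).
  by apply: le_trans (Re_le_nrm _); rewrite ReD ReN.
have tc t : nrm (t%:C - c) <= `|t - b| + 1.
  apply: le_trans (nrm_le_ReIm _) _; rewrite ReD ReN ImD ImN lerD2l.
  by rewrite /= add0r normrN.
have x_le t : nrm (t%:C - c) <= nrm (dev nu w t) * (2 + nrm (t%:C - c)).
  rewrite {1}devE nrmM ler_wpM2l ?nrm_ge0// wt.
  by apply: le_trans (nrmB _ _) _; rewrite lerD2r.
have far_dev t r : 0 < r -> r <= 1 -> r <= `|t - b| -> r <= 3 * nrm (dev nu w t).
  move=> r0 r1 rt; have := x_le t; have := le_trans rt (tb t).
  set x := nrm (t%:C - c); set p := nrm (dev nu w t) => rx xp.
  rewrite leNgt; apply/negP => pr.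
  have : p * (2 + x) <= r / 3 * (2 + x) by rewrite ler_wpM2r//; lra.
  have : x * (3 - r) >= r * 2 by rewrite ler_pM//; lra.
  have : p * (2 + x) < r / 3 * (2 + x) by rewrite ltr_pM2r; lra.
  lra.
split; first exact: defect_ge0.
- move=> r r0 r1; rewrite /q /defect -[leRHS]meanZ//.
  apply: prob_le_mean.
  + exact: measurable_far.
  + by apply: bmeasM => //; exact: bmeas_cst.
  + by move=> t; rewrite mulr_ge0 ?sqr_ge0.
  move=> t /(far_dev t r r0 r1) h.
  rewrite (_ : 9 * _ = (3 * nrm (dev nu w t)) ^+ 2); last by ring.
  by rewrite ler_pXn2r ?nnegrE ?mulr_ge0 ?nrm_ge0// ltW.
- have mb := bmeas_centred b.
  have mI : bmeas (\1_(near b 1) : R -> R) by apply: bmeas_indic; exact: measurable_near.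
  pose f t := (t%:C - c) * (\1_(near b 1) t)%:C.
  have fE : f = fun t => ((t - b) * \1_(near b 1) t)%:C - (Im c)*i * (\1_(near b 1) t)%:C.
    apply/funext => t; rewrite /f rmorphM rmorphB /= -mulrBl; congr (_ * _).
    by rewrite -addrA -opprD; congr (_ - _); apply: complex_ext; rewrite /= ?addr0 ?add0r.
  have mf : cbmeas f.
    rewrite fE; apply: cbmeasB; first exact: cbmeas_real.
    by apply: cbmeasM; [exact: cbmeas_cst|exact: cbmeas_real].
  have mean_f : Re (cmean nu f) = \int[nu]_t ((t - b) * \1_(near b 1) t).
    apply: eq_Rintegral => t _; rewrite /f ReM ReD ReN /= mulr0 subr0 //.
  rewrite -mean_f; apply: le_trans (Re_le_nrm _) _.
  have -> : cmean nu f = cmean nu (fun t => f t - F * dev nu w t).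
    rewrite cmeanB//; last exact: cbmeasZ.
    by rewrite cmeanZ// mean_dev// mulr0 subr0.
  rewrite /q /defect -[leRHS]meanZ//; apply: nrm_cmean_le.
  + by apply: cbmeasB => //; exact: cbmeasZ.
  + by apply: bmeasM => //; exact: bmeas_cst.
  move=> t; rewrite /f indicE; have [tT|tT] := boolP (t \in near b 1).
    rewrite mulr1 (_ : _ - _ = - (dev nu w t ^+ 2 * (w - t%:C))); last first.
      by rewrite expr2 -mulrA -devE; rewrite {1}devE wt; ring.
    rewrite nrmN nrmM expr2 nrmM -expr2 mulrC ler_wpM2r ?sqr_ge0// wt.
    have t1 : `|t - b| < 1 by move: tT; rewrite inE.
    apply: le_trans (nrmB _ _) _; have := tc t; lra.
  rewrite mulr0 sub0r nrmN nrmM.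
  have : 1 <= 3 * nrm (dev nu w t).
    apply: far_dev => //; rewrite leNgt; apply: contra tT => h; by rewrite inE.
  move=> h; apply: le_trans (_ : 2 * nrm (dev nu w t) <= _).
    by rewrite ler_wpM2r ?nrm_ge0.
  have : nrm (dev nu w t) * 1 <= nrm (dev nu w t) * (3 * nrm (dev nu w t)).
    by rewrite ler_wpM2l ?nrm_ge0.
  by rewrite mulr1 mulrCA -expr2; lra.
- move=> b2; rewrite /q /defect -[leRHS]meanZ//; apply: le_mean.
  + apply: (@bmeas_near01 _ (fun t => (t - b) ^+ 2) ((1 + `|b|) ^+ 2)).
      move=> t; apply: (@continuous_comp _ _ _ (fun t => t - b) (fun t => t ^+ 2));
        last exact: exprn_continuous.
      by apply: (@continuousB _ R R id (fun=> b)) => //; exact: cst_continuous.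
    move=> t t1; rewrite normrX ler_pXn2r ?nnegrE ?addr_ge0//.
    by rewrite (le_trans (ler_normB _ _))// lerD2r ltW.
  + by apply: bmeasM => //; exact: bmeas_cst.
  move=> t; rewrite indic01; case: ifPn => t1; last first.
    by rewrite mulr0 mulr_ge0 ?sqr_ge0.
  rewrite mulr1; have tb1 : `|t - b| <= 3 / 2 by have := ler_normB t b; lra.
  have x5 : nrm (t%:C - c) <= 5 / 2 by have := tc t; lra.
  have h : `|t - b| <= nrm (dev nu w t) * (9 / 2).
    apply: le_trans (tb t) (le_trans (x_le t) _).
    by rewrite ler_wpM2l ?nrm_ge0//; lra.
  rewrite -(real_normK (num_real (t - b))).
  apply: le_trans (_ : (nrm (dev nu w t) * (9 / 2)) ^+ 2 <= _).
    by rewrite ler_pXn2r ?nnegrE ?mulr_ge0 ?nrm_ge0//; lra.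
  rewrite exprMn mulrC ler_wpM2r ?sqr_ge0//; lra.
Qed.

(** i * G(i) - 1 is the mean of t / (i - t), which is at most h within distance h
    of 0. *)
Lemma F_near_i mu h : levy mu (delta0 R) < h -> h <= 10^-1 ->
  nrm (F_transform mu 'i) <= 2 /\ nrm (F_transform mu 'i - 'i) <= 10 * h.
Proof.
move=> lh h1; have h0 : 0 < h by exact: le_lt_trans (levy_ge0 mu) lh.
have i0 : 0 < Im 'i by rewrite /= ltr01.
have mr := cbmeas_res i0.
set F := F_transform mu 'i; set G := cauchy_transform mu 'i.
have FG : F * G = 1 by exact: F_cauchy.
have FGn : nrm F * nrm G = 1 by rewrite -nrmM FG nrm1.
have ni : nrm 'i = 1 by rewrite /= expr0n add0r expr1n sqrtr1.
have mI : bmeas (\1_(far 0 h) : R -> R) by apply: bmeas_indic; exact: measurable_far.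
have mI2 : bmeas (fun t => 2 * \1_(far 0 h) t) by apply: bmeasM => //; exact: bmeas_cst.
have e5 : nrm ('i * G - 1) <= 5 * h.
  have mir : cbmeas (fun t => 'i * res 'i t) by exact: cbmeasZ.
  have -> : 'i * G - 1 = cmean mu (fun t => 'i * res 'i t - 1).
    by rewrite cmeanB ?cmeanZ ?cmean_cst//; exact: cbmeas_cst.
  apply: le_trans (_ : \int[mu]_t (h + 2 * \1_(far 0 h) t) <= _).
    apply: nrm_cmean_le.
    - by apply: cbmeasB => //; exact: cbmeas_cst.
    - by apply: bmeasD => //; exact: bmeas_cst.
    have r1 t : nrm (res 'i t) <= 1 by apply: le_trans (nrm_res_le _ i0) _; rewrite /= invr1.
    move=> t; rewrite indicE; have [tT|tT] := boolP (t \in _).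
      rewrite mulr1; apply: le_trans (nrmB _ _) _; rewrite nrm1 nrmM ni mul1r.
      by have := r1 t; move: h0; lra.
    rewrite mulr0 addr0 (_ : _ - 1 = t%:C * res 'i t); last first.
      by rewrite /res; field; exact: subr_neq0.
    have th : `|t| <= h.
      by rewrite leNgt; apply: contra tT => th; rewrite inE /far /= subr0 ltW.
    by rewrite nrmM nrm_real -[leRHS]mulr1 ler_pM ?nrm_ge0.
  rewrite meanD//; last exact: bmeas_cst.
  rewrite mean_cst (meanZ mu 2 mI) mean_indic; last exact: measurable_far.
  by have := far_le_levy lh; lra.
have nF : nrm F <= 2.
  have : 2^-1 <= nrm G.
    have := nrm_sub_ge 1 ('i * G); rewrite nrm1 nrm_distC nrmM ni mul1r; lra.
  move=> /(ler_wpM2l (nrm_ge0 F)); rewrite FGn; lra.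
split => //; have -> : F - 'i = F * (1 - 'i * G).
  by rewrite mulrBr mulr1 mulrCA FG mulr1.
rewrite nrmM nrm_distC.
by apply: le_trans (ler_pM (nrm_ge0 _) (nrm_ge0 _) nF e5) _; lra.
Qed.

(** Evaluate the subordination equation at i. Its imaginary part writes
    Im F - 1 as a sum of the nonnegative terms Im F - Im (W k i), each at least
    the defect of nu k at W k i because Im (W k i) >= 1. Its real part controls
    the sum of the centres. *)
Lemma free_conv_centres (nu : nat -> prob R) n mu h :
  is_free_conv_upto nu n mu -> levy mu (delta0 R) < h -> h <= 10^-1 ->
  exists b q : nat -> R,
    [/\ forall k, (0 < k <= n)%N -> centred (nu k) (b k) (q k),
        \sum_(1 <= k < n.+1) q k <= 10 * h &
        `|\sum_(1 <= k < n.+1) b k| <= 10 * h].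
Proof.
move=> /free_conv_subordination[W [sW HW]] lh h1.
have i0 : 0 < Im 'i by rewrite /= ltr01.
have [FW sumW] := HW _ i0; have [F2 Fi] := F_near_i lh h1.
set F := F_transform mu 'i in FW sumW F2 Fi.
have W1 k : (0 < k <= n)%N -> 1 <= Im (W k 'i).
  by move=> /sW[/(_ _ i0)].
have sumE : \sum_(1 <= k < n.+1) (W k 'i - F) = 'i - F.
  by rewrite [in RHS]sumW addrC addrA addNr add0r.
have ImWF k : (0 < k <= n)%N -> Im (W k 'i) <= Im F.
  move=> kn; rewrite -(FW k kn); apply: Im_F_ge; exact: lt_le_trans (W1 k kn).
have sumI : \sum_(1 <= k < n.+1) (Im F - Im (W k 'i)) = Im (F - 'i).
  rewrite -opprB ImN -sumE Im_sum -sumrN; apply: eq_bigr => k _.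
  by rewrite ImD ImN opprB.
have IF : Im (F - 'i) <= 10 * h.
  exact: le_trans (le_trans (ler_norm _) (Im_le_nrm _)) Fi.
exists (fun k => Re (W k 'i - F)), (fun k => defect (nu k) (W k 'i)); split.
- move=> k kn; rewrite -(FW k kn); apply: subordination_centred; rewrite ?FW ?W1//.
  apply: le_trans (_ : Im (F - 'i) <= _); last by lra.
  rewrite -sumI (bigD1_seq k) ?iota_uniq//=; last by rewrite mem_index_iota ltnS.
  rewrite lerDl big_seq_cond sumr_ge0// => j /andP[].
  by rewrite mem_index_iota ltnS subr_ge0 => /ImWF.
- apply: le_trans IF; rewrite -sumI; apply: ler_sum_nat => k; rewrite ltnS => kn.
  have := Im_F (nu k) (lt_le_trans ltr01 (W1 k kn)); rewrite FW// => ->.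
  rewrite mulrDr mulr1 addrAC subrr add0r ler_peMl ?defect_ge0//; exact: W1.
- rewrite -Re_sum sumE -opprB ReN normrN.
  exact: le_trans (Re_le_nrm _) Fi.
Qed.

(** Otherwise the two sets of points far from a and from b would cover the line. *)
Lemma near_meet nu a b r s :
  fine (nu (far a r)) + fine (nu (far b s)) < 1 -> `|a - b| < r + s.
Proof.
rewrite ltNge => nu1; rewrite ltNge; apply: contra nu1 => rs.
have <- : fine (nu (far a r `|` far b s)) = 1.
  rewrite (_ : _ `|` _ = setT) ?probability_setT//.
  apply/seteqP; split=> // t _; rewrite /far /=.
  have [h|h] := leP r `|t - a|; first by left.
  right; have := ler_distD t a b; rewrite (distrC a t); lra.
by apply: prob_setU; exact: measurable_far.
Qed.

Lemma centred_trunc nu b q : centred nu b q -> `|b| <= 2^-1 ->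
  tail_mass nu + trunc_var nu <= 66 * q.
Proof.
case=> q0 farq _ /[swap] b2 /(_ b2); rewrite mean_near01_sqrB => v.
have h2 : 0 < 2^-1 :> R by rewrite invr_gt0.
have tq : tail_mass nu <= 36 * q.
  have h3 : 2^-1 <= 1 :> R by lra.
  have := farq _ h2 h3.
  have : tail_mass nu <= fine (nu (far b 2^-1)).
    apply: prob_mono; [exact: measurable_far..|].
    move=> t; rewrite /far /= subr0 => t1.
    have := ler_normD (t - b) b; rewrite subrK; lra.
  lra.
have bb : tail_mass nu * b ^+ 2 <= tail_mass nu * 4^-1.
  rewrite ler_wpM2l ?tail_mass_ge0// -(real_normK (num_real b)).
  have -> : 4^-1 = 2^-1 ^+ 2 :> R by field.
  by rewrite ler_pXn2r ?nnegrE// ltW.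
have := sqr_ge0 (trunc_mean nu - b); lra.
Qed.

(** In the scale of mu, outside an exceptional set of measure of order q + q' the
    functions x - n * b and x - m * b' are both untruncated and differ by the
    constant n * b - m * b'. *)
Lemma centred_rescale (mu : prob R) m n b b' q q' :
  (0 < m)%N -> (m <= n)%N -> centred (rescale n mu) b q ->
  centred (rescale m mu) b' q' -> q + q' <= 18^-1 ->
  `|n%:R * b - m%:R * b'| <= 48 * n%:R * (q + q').
Proof.
move=> m0 mn [q0 far1 mean1 _] [q'0 far1' mean1' _] qq.
have n0 : (0 < n)%N by exact: leq_trans mn.
have pm : 0 < m%:R :> R by rewrite ltr0n.
have pn : 0 < n%:R :> R by rewrite ltr0n.
have lmn : m%:R <= n%:R :> R by rewrite ler_nat.
set c := n%:R * b - m%:R * b'.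
have {}far1 := far1 1 ltr01 (lexx _).
have {}far1' := far1' 1 ltr01 (lexx _).
rewrite expr1n mul1r -mean_indic ?mean_rescale in far1; last 2 first.
- by apply: bmeas_indic; exact: measurable_far.
- exact: measurable_far.
rewrite expr1n mul1r -mean_indic ?mean_rescale in far1'; last 2 first.
- by apply: bmeas_indic; exact: measurable_far.
- exact: measurable_far.
rewrite (mean_rescale _ _ (bmeas_centred b)) in mean1.
rewrite (mean_rescale _ _ (bmeas_centred b')) in mean1'.
have mf := bmeas_scale n (bmeas_centred b); have mf' := bmeas_scale m (bmeas_centred b').
have mg : bmeas (fun x => \1_(far b 1) (x / n%:R) : R).
  by apply: (bmeas_scale n (f := \1_(far b 1))); apply: bmeas_indic; exact: measurable_far.
have mg' : bmeas (fun x => \1_(far b' 1) (x / m%:R) : R).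
  by apply: (bmeas_scale m (f := \1_(far b' 1))); apply: bmeas_indic; exact: measurable_far.
pose f x := (x / n%:R - b) * \1_(near b 1) (x / n%:R).
pose f' x := (x / m%:R - b') * \1_(near b' 1) (x / m%:R).
pose g x : R := \1_(far b 1) (x / n%:R).
pose g' x : R := \1_(far b' 1) (x / m%:R).
rewrite -[X in `|X| <= _]/(\int[mu]_x f x) in mean1.
rewrite -[X in `|X| <= _]/(\int[mu]_x f' x) in mean1'.
rewrite -[X in X <= _]/(\int[mu]_x g x) in far1.
rewrite -[X in X <= _]/(\int[mu]_x g' x) in far1'.
(* f and f' are the truncated functions, g and g' the indicators of the sets
   where the truncation is effective. *)
have key : `|n%:R * \int[mu]_x f x - m%:R * \int[mu]_x f' x + c| <=
    (2 * n%:R + `|c|) * (\int[mu]_x g x + \int[mu]_x g' x).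
  have mZ (r : R) p : bmeas p -> bmeas (fun t => r * p t).
    by move=> mp; apply: bmeasM => //; exact: bmeas_cst.
  have mh : bmeas (fun x => n%:R * f x - m%:R * f' x) by apply: bmeasB; exact: mZ.
  have mhc : bmeas (fun x => n%:R * f x - m%:R * f' x + c) by exact: (bmeasD mh (bmeas_cst c)).
  have mgg : bmeas (fun x => g x + g' x) by exact: bmeasD.
  have -> : n%:R * \int[mu]_x f x - m%:R * \int[mu]_x f' x + c =
      \int[mu]_x (n%:R * f x - m%:R * f' x + c).
    rewrite (meanD mu mh (bmeas_cst c)) mean_cst (meanB mu (mZ _ _ mf) (mZ _ _ mf')).
    by rewrite (meanZ mu _ mf) (meanZ mu _ mf').
  rewrite -(meanD mu mg mg') -(meanZ mu _ mgg).
  apply: le_trans (le_normr_Rintegral _ _) _ => //; first exact: bmeas_integrable.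
  apply: le_mean; [|exact: mZ|].
    have [m1 [M hM]] := mhc; split.
      by apply: measurableT_comp => //; exact: normr_measurable.
    by exists M => t; rewrite normr_id.
  move=> x.
  have fE : f x = (1 - g x) * (x / n%:R - b) /\ `|f x| <= 1 /\ (g x = 0 \/ g x = 1).
    rewrite /f /g !indicE -near_setC in_setC; have [xT|xT] /= := boolP (_ \in far b 1).
      by rewrite mulr0 subrr mul0r normr0; split=> //; split=> //; right.
    rewrite mulr1 subr0 mul1r; split=> //; split; last by left.
    by rewrite leNgt; apply: contra xT => /ltW; rewrite inE.
  have f'E : f' x = (1 - g' x) * (x / m%:R - b') /\ `|f' x| <= 1 /\ (g' x = 0 \/ g' x = 1).
    rewrite /f' /g' !indicE -near_setC in_setC; have [xT|xT] /= := boolP (_ \in far b' 1).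
      by rewrite mulr0 subrr mul0r normr0; split=> //; split=> //; right.
    rewrite mulr1 subr0 mul1r; split=> //; split; last by left.
    by rewrite leNgt; apply: contra xT => /ltW; rewrite inE.
  case: fE => e1 [e2 e3]; case: f'E => e1' [e2' e3'].
  have crude : `|n%:R * f x - m%:R * f' x + c| <= 2 * n%:R + `|c|.
    apply: le_trans (ler_normD _ _) _; rewrite lerD2r.
    apply: le_trans (ler_normB _ _) _; rewrite (normrM n%:R) (normrM m%:R) !(ger0_norm (ler0n _ _)).
    have := ler_wpM2l (ler0n R n) e2; have := ler_wpM2l (ler0n R m) e2'; lra.
  have C0 : 0 <= 2 * n%:R + `|c| by rewrite addr_ge0// mulr_ge0.
  case: e3 => e3; last first.
    by apply: le_trans crude _; rewrite e3 ler_peMr// lerDl; case: e3' => ->.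
  case: e3' => e3'; last first.
    by apply: le_trans crude _; rewrite e3 e3' add0r mulr1.
  rewrite e1 e1' e3 e3' !subr0 !mul1r addr0 mulr0.
  rewrite (_ : _ + c = 0) ?normr0//.
  by rewrite /c; field; rewrite !gt_eqF.
have {}key : `|n%:R * \int[mu]_x f x - m%:R * \int[mu]_x f' x + c| <=
    (2 * n%:R + `|c|) * (9 * (q + q')).
  have C0 : 0 <= 2 * n%:R + `|c| by rewrite addr_ge0// mulr_ge0.
  by apply: le_trans key (ler_wpM2l C0 _); lra.
have i1 : `|n%:R * \int[mu]_x f x| <= n%:R * (6 * q).
  by rewrite normrM (ger0_norm (ler0n _ _)) ler_wpM2l.
have i2 : `|m%:R * \int[mu]_x f' x| <= n%:R * (6 * q').
  by rewrite normrM (ger0_norm (ler0n _ _)) ler_pM.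
have := ler_normB (n%:R * \int[mu]_x f x - m%:R * \int[mu]_x f' x + c)
  (n%:R * \int[mu]_x f x - m%:R * \int[mu]_x f' x).
rewrite (addrC _ c) addrK.
have := ler_normB (n%:R * \int[mu]_x f x) (m%:R * \int[mu]_x f' x).
rewrite (addrC c).
have : `|c| * (9 * (q + q')) <= `|c| * 2^-1 by rewrite ler_wpM2l//; lra.
move: key; lra.
Qed.

End Centring.

(** * Necessity *)

Section Necessity.
Variable R : realType.
Variables (mu mun : nat -> prob R).
Hypothesis freemu : forall n : nat, (0 < n)%N ->
  is_free_conv_upto (fun k => rescale n (mu k)) n (mun n).

(* The most demanding inequality is 64 * 90 * h0 < 1/2, for the mass at distance
   1/8 from the centre of the last summand. *)
Let h0 : R := 100^-1 / 120.

Let h0_gt0 : 0 < h0. Proof. by rewrite /h0; lra. Qed.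

(** The hypothesis at one n says nothing about the size of the individual
    summands: point masses at 2 and -2 cancel. But the unscaled centres of
    mu 1, ..., mu m obtained at the stages m and m + 1 differ, summed over k, by a
    small multiple of m + 1 only, and both families have a small sum; the
    centre of mu (m + 1) is therefore small. *)
Lemma last_summand_small m : (0 < m)%N -> levy (mun m) (delta0 R) < h0 ->
  levy (mun m.+1) (delta0 R) < h0 ->
  fine (rescale m.+1 (mu m.+1) (far 0 4^-1)) < 2^-1.
Proof.
move=> m0 lm ln; set n := m.+1; have n0 : (0 < n)%N by [].
have h10 : h0 <= 10^-1 by rewrite /h0; lra.
have [b' [q' [cb' sq' sb']]] := free_conv_centres (freemu m0) lm h10.
have [b [q [cb sq sb]]] := free_conv_centres (freemu n0) ln h10.
have q_ge0 k : (0 < k <= n)%N -> 0 <= q k by move=> /cb[].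
have q'_ge0 k : (0 < k <= m)%N -> 0 <= q' k by move=> /cb'[].
have kmn k : (0 < k <= m)%N -> (0 < k <= n)%N by move=> /andP[-> km]; exact: leqW.
have pn : 0 < n%:R :> R by rewrite ltr0n.
have nm : m%:R <= n%:R :> R by rewrite ler_nat leqnSn.
have sqm : \sum_(1 <= k < m.+1) q k <= 10 * h0.
  apply: le_trans sq; rewrite [leRHS]big_nat_recr//= lerDl.
  by apply: q_ge0; rewrite leqnn.
have qn : q n <= 10 * h0.
  apply: le_trans sq; rewrite [leRHS]big_nat_recr//= lerDr.
  by rewrite big_nat_cond sumr_ge0// => k /andP[]; rewrite ltnS => /kmn/q_ge0.
have q_le k : (0 < k <= m)%N -> q k + q' k <= 18^-1.
  move=> km; have mk : k \in index_iota 1 m.+1 by rewrite mem_index_iota ltnS.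
  apply: le_trans (_ : \sum_(1 <= k < m.+1) q k + \sum_(1 <= k < m.+1) q' k <= _).
    apply: lerD; rewrite (bigD1_seq k) ?iota_uniq//= lerDl big_seq_cond sumr_ge0//;
      move=> j /andP[]; rewrite mem_index_iota ltnS => jm _.
      exact/q_ge0/kmn.
    exact: q'_ge0.
  by move: sqm sq'; rewrite /h0; lra.
have diff : `|\sum_(1 <= k < m.+1) (n%:R * b k - m%:R * b' k)| <= n%:R * (960 * h0).
  apply: le_trans (ler_norm_sum _ _ _) _.
  apply: le_trans (_ : \sum_(1 <= k < m.+1) 48 * n%:R * (q k + q' k) <= _).
    apply: ler_sum_nat => k; rewrite ltnS => km.
    by apply: (centred_rescale m0 (leqnSn m)); [exact/cb/kmn|exact: cb'|exact: q_le].
  rewrite -mulr_sumr big_split /= mulrAC mulrC ler_pM2l//; move: sqm sq'; lra.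
have bn : `|b n| <= 980 * h0.
  have E : n%:R * b n = n%:R * (\sum_(1 <= k < n.+1) b k) - m%:R * (\sum_(1 <= k < m.+1) b' k)
      - \sum_(1 <= k < m.+1) (n%:R * b k - m%:R * b' k).
    by rewrite big_nat_recr//= sumrB -!mulr_sumr; ring.
  rewrite -(ler_pM2l pn) -[X in X * `|_|](gtr0_norm pn) -normrM E.
  apply: le_trans (ler_normB _ _) _.
  have := ler_normB (n%:R * (\sum_(1 <= k < n.+1) b k)) (m%:R * (\sum_(1 <= k < m.+1) b' k)).
  have e1 : `|n%:R * (\sum_(1 <= k < n.+1) b k)| <= n%:R * (10 * h0).
    by rewrite normrM (gtr0_norm pn) ler_pM2l.
  have e2 : `|m%:R * (\sum_(1 <= k < m.+1) b' k)| <= n%:R * (10 * h0).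
    by rewrite normrM (ger0_norm (ler0n _ _)) ler_pM.
  move: diff e1 e2; lra.
have [_ /(_ 8^-1)far8 _ _] := cb n (leqnn n).
have {}far8 : 8^-1 ^+ 2 * fine (rescale n (mu n) (far (b n) 8^-1)) <= 9 * q n.
  by apply: far8; lra.
apply: le_lt_trans (_ : fine (rescale n (mu n) (far (b n) 8^-1)) < _).
  apply: prob_mono; [exact: measurable_far..|].
  move=> t; rewrite /far /= subr0 => t4.
  have := ler_normD (t - b n) (b n); rewrite subrK.
  move: bn t4; rewrite /h0; lra.
move: far8 qn; rewrite /h0; lra.
Qed.

Hypothesis levy0 : levy (mun n) (delta0 R) @[n --> \oo] --> (0 : R).

Lemma eventually_levy_lt h : 0 < h ->
  exists N, forall n, (N <= n)%N -> levy (mun n) (delta0 R) < h.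
Proof.
move=> h_gt0; have /cvgrPdist_lt/(_ _ h_gt0)[N _ HN] := levy0.
by exists N => n /HN /=; rewrite sub0r normrN ger0_norm// levy_ge0.
Qed.

(** For large k, mu k is small at scale k, hence at every scale n >= k; the finitely
    many remaining measures are tight. *)
Lemma eventually_infinitesimal : exists N, forall n, (N <= n)%N ->
  forall k, (0 < k <= n)%N -> fine (rescale n (mu k) (far 0 4^-1)) < 2^-1.
Proof.
have [N HN] := eventually_levy_lt h0_gt0.
have [M M0 HM] : exists2 M : R, 0 < M & forall k, (k <= N.+1)%N -> fine (mu k (far 0 M)) < 2^-1.
  elim: N.+1 => [|j [M M0 IH]].
    have [|M M0 HM] := @tight _ (mu 0%N) 2^-1; first by rewrite invr_gt0.
    by exists M => // k; rewrite leqn0 => /eqP ->.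
  have [|M' M'0 HM] := @tight _ (mu j.+1) 2^-1; first by rewrite invr_gt0.
  have mono a b k : a <= b -> fine (mu k (far 0 a)) < 2^-1 -> fine (mu k (far 0 b)) < 2^-1.
    move=> ab; apply: le_lt_trans; apply: prob_mono; [exact: measurable_far..|].
    by move=> t; apply: le_trans.
  exists (Num.max M M'); first by rewrite lt_max M0.
  move=> k; rewrite leq_eqVlt => /predU1P[->|kj].
    by apply: mono HM; rewrite le_max lexx orbT.
  by apply: mono (IH _ kj); rewrite le_max lexx.
exists (Num.truncn (4 * M)).+1 => n Mn k /andP[k0 kn].
have n0 : (0 < n)%N by exact: leq_trans kn.
rewrite far_rescale// mulr0.
have [kN|Nk] := leqP k N.+1.
  apply: le_lt_trans (HM k kN); apply: prob_mono; [exact: measurable_far..|].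
  move=> t; apply: le_trans; rewrite ler_pdivlMr// mulrC.
  by apply: le_trans (ltW (truncnS_gt _)) _; rewrite ler_nat.
case: k k0 kn Nk => [//|m] _ mn Nm; rewrite ltnS in Nm.
have m0 : (0 < m)%N by exact: leq_trans Nm.
have := last_summand_small m0 (HN _ (ltnW Nm)) (HN _ (leqW (ltnW Nm))).
rewrite far_rescale// mulr0; apply: le_lt_trans; apply: prob_mono; [exact: measurable_far..|].
by move=> t; apply: le_trans; rewrite ler_wpM2r ?invr_ge0// ler_nat.
Qed.

(** The summands being infinitesimal, their centres lie in (-1/2, 1/2), where the
    costs dominate the tails and the truncated variances. *)
Lemma eta13_le (e : R) : 0 < e -> exists N, forall n, (N <= n)%N ->
  eta1 mu n + eta3 mu n <= e.
Proof.
move=> e0; have [N1 H1] := eventually_infinitesimal.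
pose h := Num.min (e / 660) h0.
have h_gt0 : 0 < h by rewrite lt_min h0_gt0 andbT; lra.
have [he hh0] : h <= e / 660 /\ h <= h0 by rewrite !ge_min !lexx orbT.
have [N2 H2] := eventually_levy_lt h_gt0.
exists (maxn 1 (maxn N1 N2)) => n; rewrite !geq_max => /and3P[n0 /H1 inf /H2 lev].
have h10 : h <= 10^-1 by apply: le_trans hh0 _; rewrite /h0; lra.
have [b [q [cb sq sb]]] := free_conv_centres (freemu n0) lev h10.
have q_le k : (0 < k <= n)%N -> q k <= 10 * h0.
  move=> kn; apply: le_trans (le_trans sq _); last by rewrite ler_pM2l.
  rewrite (bigD1_seq k) ?iota_uniq//= ?mem_index_iota ?ltnS// lerDl big_seq_cond sumr_ge0//.
  by move=> j /andP[]; rewrite mem_index_iota ltnS => /cb[].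
rewrite eta1E// eta3E// -big_split /=.
apply: le_trans (_ : \sum_(1 <= k < n.+1) 66 * q k <= _); last first.
  rewrite -mulr_sumr; move: sq he; lra.
apply: ler_sum_nat => k; rewrite ltnS => kn; apply: centred_trunc; first exact: cb.
have [_ far4 _ _] := cb k kn.
have {}far4 : 4^-1 ^+ 2 * fine (rescale n (mu k) (far (b k) 4^-1)) <= 9 * q k.
  by apply: far4; lra.
have : `|b k - 0| < 4^-1 + 4^-1.
  apply: (@near_meet _ (rescale n (mu k))).
  have := inf k kn; have := q_le k kn; move: far4; rewrite /h0; lra.
rewrite subr0; lra.
Qed.

Lemma eta1_cvg0 : eta1 mu @ \oo --> (0 : R).
Proof.
apply/cvgrPdist_le => e e0; have [N HN] := eta13_le e0.
near=> n; rewrite sub0r normrN ger0_norm ?eta1_ge0//.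
have Nn : (N <= n)%N by near: n; exists N.
have n0 : (0 < n)%N by near: n; exists 1%N.
by apply: le_trans (HN n Nn); rewrite lerDl eta3_ge0.
Unshelve. all: by end_near. Qed.

Lemma eta3_cvg0 : eta3 mu @ \oo --> (0 : R).
Proof.
apply/cvgrPdist_le => e e0; have [N HN] := eta13_le e0.
near=> n; have Nn : (N <= n)%N by near: n; exists N.
have n0 : (0 < n)%N by near: n; exists 1%N.
rewrite sub0r normrN ger0_norm ?eta3_ge0//.
by apply: le_trans (HN n Nn); rewrite lerDr eta1_ge0.
Unshelve. all: by end_near. Qed.

(** mun n is concentrated near eta2 by [far_eta2_le] and near 0 by hypothesis. *)
Lemma eta2_cvg0 : eta2 mu @ \oo --> (0 : R).
Proof.
apply/cvgrPdist_le => e e0.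
have [y [y0 y1 ye]] : exists y : R, [/\ 0 < y, y < 4^-1 & y <= e / 2].
  exists (Num.min (e / 2) 5^-1); rewrite lt_min gt_min ge_min lexx.
  by split=> //; [apply/andP; split; lra|apply/orP; right; lra].
have d0 : 0 < y ^+ 3 / 10 by rewrite divr_gt0// exprn_gt0.
have [N HN] := eta13_le d0; have [N' HN'] := eventually_levy_lt y0.
near=> n; have Nn : (N <= n)%N by near: n; exists N.
have N'n : (N' <= n)%N by near: n; exists N'.
have n0 : (0 < n)%N by near: n; exists 1%N.
have y_lt1 : y < 1 by lra.
have far1 : fine (mun n (far (eta2 mu n) y)) <= y.
  apply: (far_eta2_le freemu) => //; have := HN n Nn; lra.
have far2 := far_le_levy (HN' n N'n).
rewrite distrC; apply: le_trans (_ : y + y <= _); last by lra.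
by apply/ltW/(@near_meet _ (mun n)); lra.
Unshelve. all: by end_near. Qed.

End Necessity.

Unset Implicit Arguments.

(* mu j is used for j >= 1 only, and mun n stands for the n-th free
   convolution, n >= 1. *)
Theorem theorem2p7 (R : realType) :
  (forall (mu : nat -> prob R) (mun : nat -> prob R),
     (forall n : nat, (0 < n)%N ->
        is_free_conv_upto (fun k => rescale n (mu k)) n (mun n)) ->
     ((fun n : nat => levy (mun n) (delta0 R)) @ \oo --> (0 : R) <->
      [/\ eta1 mu @ \oo --> (0 : R),
          eta2 mu @ \oo --> (0 : R) &
          eta3 mu @ \oo --> (0 : R)])) /\
  (exists c : R, 0 < c /\
     forall (mu : nat -> prob R) (mun : nat -> prob R),
     (forall n : nat, (0 < n)%N ->
        is_free_conv_upto (fun k => rescale n (mu k)) n (mun n)) ->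
     forall n : nat, (0 < n)%N ->
       levy (mun n) (delta0 R) <=
         c * ((eta1 mu n + eta3 mu n) `^ 6%:R^-1 + `|eta2 mu n|)).
Proof.
split=> [mu mun freemu|].
  split=> [levy0|[c1 c2 c3]]; last exact: levy_cvg0 freemu c1 c2 c3.
  by split; [exact: eta1_cvg0 levy0|exact: eta2_cvg0 levy0|exact: eta3_cvg0 levy0].
by exists 3; split=> // mu mun freemu n n0; exact: levy_rate.
Qed.
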